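(* Let $F$ and $G$ be Banach spaces such that (i) every bounded linear map $G\to F$ is compact; (ii) both $F$ and $G$ are isomorphic to their hyperplanes. Let $X=F\oplus G$ and let $P_F\in\mathcal{P}(\mathcal{L}(X))$ be the projector onto $F$ with kernel $G$. Then $\mathrm{sf}_{P_F}=0$.
   Context: A hyperplane of a Banach space is a closed subspace of codimension one; isomorphic means linearly homeomorphic. Banach spaces are real or complex; spectra of operators on real spaces are taken in the complexification. $\mathcal{L}(X)$ is the Banach algebra of bounded operators on $X$, $\mathcal{L}_c(X)$ the ideal of compact operators, $\mathcal{C}(X)=\mathcal{L}(X)/\mathcal{L}_c(X)$ the Calkin algebra, $\mathcal{P}(\mathcal{L}(X))=\{Q\in\mathcal{L}(X):Q^2=Q\}$ the set of projectors. An operator $A\in\mathcal{L}(X)$ is essentially hyperbolic if the spectrum of $A+\mathcal{L}_c(X)$ in $\mathcal{C}(X)$ does not meet $i\mathbb{R}$; $e\mathcal{H}(X)$ is the set of such operators, with the operator norm topology. For $A\in e\mathcal{H}(X)$, $\sigma(A)\cap i\mathbb{R}$ is finite and consists of isolated points of $\sigma(A)$, and $P^+(A)$ denotes the (Riesz) spectral projector of $A$ relative to $\sigma(A)\cap\{\mathrm{Re}(z)>0\}$. For projectors $Q,R$ with $Q-R$ compact, $[Q-R]$ denotes the Fredholm index of $R|_{\mathrm{Range}(Q)}\colon\mathrm{Range}(Q)\to\mathrm{Range}(R)$. For a continuous path $A\colon[0,1]\to e\mathcal{H}(X)$, the spectral flow is $$\mathrm{sf}(A)=[Q(0)-P^+(A(0))]-[Q(1)-P^+(A(1))],$$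 where $Q\colon[0,1]\to\mathcal{P}(\mathcal{L}(X))$ is any continuous path of projectors with $Q(t)-P^+(A(t))$ compact for all $t$ (such $Q$ exists and the integer does not depend on its choice). For a projector $P$, $\mathrm{sf}_P\colon\pi_1(e\mathcal{H}(X),2P-I)\to\mathbb{Z}$ is the group homomorphism induced by the spectral flow on loops based at $2P-I$. *)

(* Defs.v *)
From HB Require Import structures.
From mathcomp Require Import all_boot all_order all_algebra.
From mathcomp Require Import complex.
From mathcomp Require Import all_classical all_reals all_analysis.
From mathcomp Require Import ring lra.

Set Implicit Arguments.
Unset Strict Implicit.
Unset Printing Implicit Defensive.

Import Order.TTheory GRing.Theory Num.Theory.
Import numFieldNormedType.Exports.

Local Open Scope classical_set_scope.
Local Open Scope ring_scope.
Local Open Scope complex_scope.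

Section Complexification.
Variables (R : realType) (X : normedModType R).

(* X + iX, the pair (x, y) standing for x + iy. *)
Definition complexification : Type := (X * X)%type.

HB.instance Definition _ := Choice.copy complexification (X * X)%type.
HB.instance Definition _ := GRing.Zmodule.copy complexification (X * X)%type.

Implicit Types (z w : complexification) (l : R[i]).

Definition cplx_scale l z : complexification :=
  (complex.Re l *: z.1 - complex.Im l *: z.2,
   complex.Re l *: z.2 + complex.Im l *: z.1).

Let rot_re (a b c d : R) (x y : X) :
  a *: (c *: x - d *: y) - b *: (c *: y + d *: x) =
  (a * c - b * d) *: x - (a * d + b * c) *: y.
Proof.
rewrite scalerBr scalerDr !scalerA scalerBl scalerDl !opprD.
by rewrite -!addrA; congr (_ + _); rewrite [RHS]addrC -addrA; congr (_ + _); rewrite addrC.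
Qed.

Let rot_im (a b c d : R) (x y : X) :
  a *: (c *: y + d *: x) + b *: (c *: x - d *: y) =
  (a * c - b * d) *: y + (a * d + b * c) *: x.
Proof.
rewrite scalerBr scalerDr !scalerA scalerBl scalerDl.
by rewrite -!addrA; congr (_ + _); rewrite [RHS]addrC -addrA.
Qed.

Let scaleA l m z : cplx_scale l (cplx_scale m z) = cplx_scale (l * m) z.
Proof. by case: l m z => [a b] [c d] [x y]; congr pair; rewrite /= ?rot_re ?rot_im. Qed.

Let scale1 : left_id 1 cplx_scale.
Proof. by case=> x y; congr pair; rewrite /= !scale1r scale0r ?subr0 ?addr0. Qed.

Let scaleDr : right_distributive cplx_scale +%R.
Proof.
move=> [a b] [x y] [x' y']; congr pair; rewrite /= !scalerDr ?opprD;
  by rewrite addrACA.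
Qed.

Let scaleDl z : {morph cplx_scale^~ z : l m / l + m}.
Proof.
move=> [a b] [c d]; case: z => x y; congr pair; rewrite /= !scalerDl ?opprD;
  by rewrite addrACA.
Qed.

HB.instance Definition _ := GRing.Zmodule_isLmodule.Build R[i] complexification
  scaleA scale1 scaleDr scaleDl.

(* The norms of the real parts of the rotations e^(i theta) (x + iy); their
   supremum is a norm over R[i] inducing the topology of X * X and
   restricting to the norm of X. *)
Definition cplx_rotations z : set R :=
  [set r | exists a b : R, a ^+ 2 + b ^+ 2 = 1 /\ r = `|a *: z.1 - b *: z.2|].

Definition cplx_norm z : R[i] := (sup (cplx_rotations z))%:C.

Let unit_le1 (a b : R) : a ^+ 2 + b ^+ 2 = 1 -> `|a| <= 1 /\ `|b| <= 1.
Proof. by move=> ab; split; rewrite ler_norml; apply/andP; split; nra. Qed.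

Let rotations_sup z : has_sup (cplx_rotations z).
Proof.
split; first by exists `|1 *: z.1 - 0 *: z.2|; exists 1, 0; split => //; ring.
exists (`|z.1| + `|z.2|) => _ [a [b [/unit_le1[a1 b1] ->]]].
rewrite (le_trans (ler_normB _ _))// !normrZ.
by rewrite lerD// ler_piMl.
Qed.

Let le_norm z a b : a ^+ 2 + b ^+ 2 = 1 ->
  `|a *: z.1 - b *: z.2| <= sup (cplx_rotations z).
Proof.
by move=> ab; apply: sup_upper_bound; [exact: rotations_sup|exists a, b].
Qed.

Let norm_le z M :
  (forall a b, a ^+ 2 + b ^+ 2 = 1 -> `|a *: z.1 - b *: z.2| <= M) ->
  sup (cplx_rotations z) <= M.
Proof.
move=> zM; apply: ge_sup; first by case: (rotations_sup z).
by move=> _ [a [b [/zM ? ->]]].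
Qed.

Let norm_triangle z w : cplx_norm (z + w) <= cplx_norm z + cplx_norm w.
Proof.
rewrite /cplx_norm -rmorphD lecR; apply: norm_le => a b ab.
have -> : a *: (z + w).1 - b *: (z + w).2 =
    (a *: z.1 - b *: z.2) + (a *: w.1 - b *: w.2).
  by rewrite /= !scalerDr opprD addrACA.
by rewrite (le_trans (ler_normD _ _))// lerD// le_norm.
Qed.

Let norm0 : sup (cplx_rotations 0) = 0.
Proof.
apply/eqP; rewrite eq_le; apply/andP; split.
  by apply: norm_le => a b _; rewrite /= !scaler0 subr0 normr0.
have /(le_norm 0) : (1 : R) ^+ 2 + 0 ^+ 2 = 1 by ring.
exact: le_trans.
Qed.

Let norm_scale_le l z :
  sup (cplx_rotations (l *: z)) <= complex.Re `|l| * sup (cplx_rotations z).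
Proof.
have [->|l0] := eqVneq l 0; first by rewrite scale0r normr0 mul0r norm0.
apply: norm_le => a b ab; case: l l0 => c d l0; rewrite /= rot_re.
set r := Num.sqrt _.
have r2 : r ^+ 2 = c ^+ 2 + d ^+ 2 by rewrite sqr_sqrtr ?addr_ge0 ?sqr_ge0.
have r0 : r != 0.
  apply: contra l0 => /eqP r0; move: r2; rewrite r0 expr0n /= => /esym/eqP.
  by rewrite paddr_eq0 ?sqr_ge0// !sqrf_eq0 eq_complex.
have rgt0 : 0 < r by rewrite lt_def r0 sqrtr_ge0.
set p := a * c - b * d; set q := a * d + b * c.
have -> : p *: z.1 - q *: z.2 = r *: ((p / r) *: z.1 - (q / r) *: z.2).
  by rewrite scalerBr !scalerA ![r * _]mulrC !divfK.
rewrite normrZ gtr0_norm// ler_pM2l// le_norm// !exprMn exprVn -mulrDl r2.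
have -> : p ^+ 2 + q ^+ 2 = (a ^+ 2 + b ^+ 2) * (c ^+ 2 + d ^+ 2).
  by rewrite /p /q; ring.
by rewrite ab mul1r divff// -r2 expf_eq0.
Qed.

Let norm_scale l z : cplx_norm (l *: z) = `|l| * cplx_norm z.
Proof.
have nE (m : R[i]) : `|m| = (complex.Re `|m|)%:C by rewrite normc_def.
have [->|l0] := eqVneq l 0.
  by rewrite scale0r normr0 mul0r /cplx_norm norm0.
apply/eqP; rewrite eq_le; apply/andP; split.
  by rewrite nE /cplx_norm -rmorphM lecR norm_scale_le.
have nl : 0 < `|l| by rewrite normr_gt0.
rewrite -ler_pdivlMl// -normfV.
rewrite -[X in cplx_norm X](scale1r z) -(mulVf l0) -scalerA.
by rewrite nE /cplx_norm -rmorphM lecR norm_scale_le.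
Qed.

Let norm_eq0 z : cplx_norm z = 0 -> z = 0.
Proof.
move=> [] z0; case: z z0 => x y z0.
have /(le_norm (x, y)) : (1 : R) ^+ 2 + 0 ^+ 2 = 1 by ring.
have /(le_norm (x, y)) : (0 : R) ^+ 2 + 1 ^+ 2 = 1 by ring.
rewrite z0 /= !scale1r !scale0r sub0r subr0 normrN !normr_le0.
by move=> /eqP -> /eqP ->.
Qed.

HB.instance Definition _ := Lmodule_isNormed.Build R[i] complexification
  norm_triangle norm_scale norm_eq0.

End Complexification.

Section Operators.
Variable K : numFieldType.

Definition bounded_op (X Y : normedModType K) : set (X -> Y) :=
  [set T | linear T /\ continuous T].

Definition compact_op (X Y : normedModType K) : set (X -> Y) :=
  [set T | bounded_op T /\ precompact (T @` [set x | `|x| <= 1])].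

Definition projector (X : normedModType K) : set (X -> X) :=
  [set Q | bounded_op Q /\ Q \o Q = Q].

(* `T` has operator norm at most `M`. *)
Definition opnorm_le (X Y : normedModType K) (T : X -> Y) (M : K) :=
  forall x, `|T x| <= M * `|x|.

(* Continuity on `D` for the operator norm topology. *)
Definition norm_continuous_on (T : topologicalType) (X : normedModType K)
    (D : set T) (A : T -> X -> X) :=
  forall t, D t -> forall e : K, 0 < e ->
    \forall s \near within D (nbhs t), opnorm_le (A s - A t) e.

Definition subspace_set (X : normedModType K) (V : set X) :=
  V 0 /\ forall (a : K) u v, V u -> V v -> V (a *: u + v).

(* dim (V / W) = n, for linear subspaces W of V. *)
Definition quotient_dim (X : normedModType K) (V W : set X) (n : nat) :=
  exists e : 'I_n -> X, (forall i, V (e i)) /\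
    forall v, V v -> exists! c : 'I_n -> K, W (v - \sum_(i < n) c i *: e i).

Definition hyperplane (X : normedModType K) (H : set X) :=
  [/\ subspace_set H, closed H & quotient_dim setT H 1].

(* The whole space `X` and its subspace `H` are linearly homeomorphic. *)
Definition isomorphic_to_subspace (X : normedModType K) (H : set X) :=
  exists f g : X -> X,
    [/\ linear f /\ continuous f, {within H, continuous g},
        forall x, H (f x), cancel f g & {in H, cancel g f}].

Definition isomorphic_to_hyperplanes (X : normedModType K) :=
  forall H : set X, hyperplane H -> isomorphic_to_subspace H.

(* `T`, restricted to V -> W, is Fredholm of index `k`. *)
Definition fredholm_index (X : normedModType K) (V W : set X) (T : X -> X)
    (k : int) :=
  exists n m : nat, [/\ quotient_dim (V `&` [set v | T v = 0]) [set 0] n,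
    quotient_dim W (T @` V) m & k = n%:Z - m%:Z].

(* [Q - P] = k. *)
Definition relative_dim (X : normedModType K) (Q P : X -> X) (k : int) :=
  fredholm_index (range Q) (range P) P k.

End Operators.

Section Spectrum.
Variables (R : realType) (X : normedModType R[i]).
Implicit Types (A B P : X -> X) (z : R[i]).

Definition resolvent_at A z B :=
  [/\ bounded_op B, (z *: idfun - A) \o B = idfun
    & B \o (z *: idfun - A) = idfun].

Definition spectrum A : set R[i] := [set z | ~ exists B, resolvent_at A z B].

(* The spectrum of A + L_c(X) in the Calkin algebra: equality of classes is
   equality up to a compact operator. *)
Definition calkin_spectrum A : set R[i] :=
  [set z | ~ exists B, [/\ bounded_op B,
    compact_op ((z *: idfun - A) \o B - idfun)
    & compact_op (B \o (z *: idfun - A) - idfun)]].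

(* Riemann integral in operator norm, as a limit over tagged partitions. *)
Definition is_op_integral (f : R -> X -> X) (a b : R) (J : X -> X) :=
  forall e : R, 0 < e -> exists2 d : R, 0 < d &
    forall (n : nat) (p xi : nat -> R), p 0%N = a -> p n = b ->
      (forall i, (i < n)%N -> p i <= xi i <= p i.+1 /\ p i.+1 - p i < d) ->
      opnorm_le (\sum_(i < n) (p i.+1 - p i)%:C *: f (xi i) - J) e%:C.

(* `P` is the Riesz projector of `A` relative to `S`, that is, the integral of
   (z - A)^-1 dz / (2 pi i) over a positively oriented circle which lies in
   the resolvent set and encloses exactly the part `S` of the spectrum. When
   `A` is essentially hyperbolic, the part of the spectrum in Re z > 0 is
   compact, hence enclosed by such a circle (large, inside Re z > 0). *)
Definition riesz_projector A (S : set R[i]) P :=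
  exists (c : R[i]) (r : R) (Res : R[i] -> X -> X),
    let u (theta : R) : R[i] := r%:C * (cos theta +i* sin theta) in
    [/\ 0 < r, forall z, `|z - c| = r%:C -> resolvent_at A z (Res z),
        S = spectrum A `&` [set z | `|z - c| < r%:C]
      & is_op_integral
          (fun theta => ((0 +i* (2 * pi))^-1 * ((0 +i* 1) * u theta)) *:
             Res (c + u theta)) 0 (2 * pi) P].

End Spectrum.

Variant scalar_kind := RealScalars | ComplexScalars.

Definition scalar_field (R : realType) (k : scalar_kind) : numFieldType :=
  match k with RealScalars => R | ComplexScalars => R[i] end.

(* The complex space, and the operator on it, in which spectra are taken. *)
Definition cplx_space (R : realType) (k : scalar_kind) :
    normedModType (scalar_field R k) -> normedModType R[i] :=
  match k with
  | RealScalars => fun X => complexification X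
  | ComplexScalars => fun X => X
  end.

Definition cplx_op (R : realType) (k : scalar_kind) :
    forall X : normedModType (scalar_field R k),
      (X -> X) -> cplx_space X -> cplx_space X :=
  match k with
  | RealScalars => fun X T z => (T z.1, T z.2)
  | ComplexScalars => fun X T => T
  end.

Section SpectralFlow.
Variables (R : realType) (k : scalar_kind) (X : normedModType (scalar_field R k)).
Implicit Types (P T : X -> X) (A B : R -> X -> X).

Definition ess_hyperbolic : set (X -> X) :=
  [set T | bounded_op T /\
    forall z, calkin_spectrum (cplx_op T) z -> complex.Re z <> 0].

(* P = P^+(T) *)
Definition is_positive_projector T P :=
  bounded_op P /\ riesz_projector (cplx_op T)
    (spectrum (cplx_op T) `&` [set z | 0 < complex.Re z]) (cplx_op P).

(* sf(A) = n. Paths are parametrized by the interval [0, 1]; their values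
   outside of it are irrelevant. *)
Definition spectral_flow A (n : int) :=
  exists Q Pp : R -> X -> X,
    [/\ norm_continuous_on (`[0, 1] : set R) Q,
        forall t, 0 <= t <= 1 -> [/\ projector (Q t),
          is_positive_projector (A t) (Pp t) & compact_op (Q t - Pp t)]
      & exists k0 k1, [/\ relative_dim (Q 0) (Pp 0) k0,
          relative_dim (Q 1) (Pp 1) k1 & n = k0 - k1]].

Definition loops (E : set (X -> X)) (T : X -> X) : set (R -> X -> X) :=
  [set A | [/\ norm_continuous_on (`[0, 1] : set R) A, forall t, 0 <= t <= 1 -> E (A t),
    A 0 = T & A 1 = T]].

Definition loop_homotopic (E : set (X -> X)) (T : X -> X) A B :=
  exists H : R * R -> X -> X,
    [/\ norm_continuous_on ((`[0, 1] `*` `[0, 1]) : set (R * R)) H,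
        forall p, 0 <= p.1 <= 1 -> 0 <= p.2 <= 1 -> E (H p),
        forall t, 0 <= t <= 1 -> H (0, t) = A t /\ H (1, t) = B t
      & forall s, 0 <= s <= 1 -> H (s, 0) = T /\ H (s, 1) = T].

(* The elements of pi_1(E, T), as homotopy classes of loops. *)
Definition fundamental_group (E : set (X -> X)) (T : X -> X) :
    set (set (R -> X -> X)) :=
  [set C | exists2 A, loops E T A &
    C = [set B | loops E T B /\ loop_homotopic E T A B]].

(* sf_P(C) = n, for a class C in pi_1(eH(X), 2P - I). *)
Definition spectral_flow_hom (C : set (R -> X -> X)) (n : int) :=
  exists2 A, C A & spectral_flow A n.

End SpectralFlow.

Definition left_projector (K : numFieldType) (F G : normedModType K)
  (x : F * G) : F * G := (x.1, 0).

(* Main.v *)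
Require Import Defs.
From HB Require Import structures.
From mathcomp Require Import all_boot all_order all_algebra.
From mathcomp Require Import complex.
From mathcomp Require Import all_classical all_reals all_analysis.
From mathcomp Require Import ring lra zify.

Set Implicit Arguments.
Unset Strict Implicit.
Unset Printing Implicit Defensive.

Import Order.TTheory GRing.Theory Num.Theory.
Import numFieldNormedType.Exports.

Local Open Scope classical_set_scope.
Local Open Scope ring_scope.

(** The operator 2 P_F - 1 has the eigenspaces F and G, so its positive
    spectral projector is P_F. A loop based at this operator therefore comes
    with a path of projectors Q such that Q(0) - P_F and Q(1) - P_F are
    compact, and its spectral flow is [Q(0) - P_F] - [Q(1) - P_F]. It vanishes
    because the index of P_F from the range of Q(t) to F is defined for every
    t, although Q(t) - P_F need not be compact, and does not depend on t.

    Write Q in blocks a : F -> F, b : G -> F, c : F -> G, d : G -> G. As b is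
    compact, Q^2 = Q makes a idempotent modulo compact operators. In the
    Calkin algebra of F an idempotent close to 1 is 1
    ([idempotent_mod_compact]); hence a(t) is 1 + compact for all t, since it
    is so at t = 0. Compactness of the operators from G to F also makes the
    compression to F multiplicative modulo compact operators ([corner_comp]).

    Two close projectors are intertwined by an automorphism of the whole space
    ([intertwiner_bijective]). Composing such automorphisms along the path
    gives an automorphism U with U Q(0) = Q(1) U, and the composite
    F -> range Q(0) -> range Q(1) -> F of Q(0), U and P_F is 1 + compact,
    being modulo compact operators a product of diagonal blocks
    ([transported_step]). So is F -> range Q(0) -> F, without U. By the theory
    of Riesz these composites have index 0 ([riesz_schauder]), and by
    additivity ([index_comp]) the indices of both projections are opposite to
    the index of F -> range Q(0) ([transported_relative_dim]).

    Riesz's theorem rests on the fact that chains of closed subspaces related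
    by 1 - k have bounded length when k is compact ([riesz_chain]); applied to
    the kernels and ranges of the powers of 1 - k, it reduces the computation
    of the index to a finite-dimensional space ([stationary_index0]). That
    P_F is the positive projector of 2 P_F - 1 is checked on eigenvectors,
    where the Cauchy integral is a scalar integral and its Riemann sums can be
    computed at roots of unity ([circle_mean]). *)

(** * Subspaces and dimensions of quotients *)

Section Subspaces.
Variables (K : numFieldType) (X : normedModType K).
Implicit Types V W : set X.

Lemma subspaceD V u v : subspace_set V -> V u -> V v -> V (u + v).
Proof. by move=> [_ hV] Vu Vv; rewrite -[u]scale1r; exact: hV. Qed.

Lemma subspaceZ V (a : K) u : subspace_set V -> V u -> V (a *: u).
Proof. by move=> [V0 hV] Vu; rewrite -[_ *: _]addr0; exact: hV. Qed.

Lemma subspaceN V u : subspace_set V -> V u -> V (- u).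
Proof. by move=> hV Vu; rewrite -scaleN1r; exact: subspaceZ. Qed.

Lemma subspaceB V u v : subspace_set V -> V u -> V v -> V (u - v).
Proof. by move=> hV Vu Vv; apply: subspaceD => //; exact: subspaceN. Qed.

Lemma subspace_sum V n (e : 'I_n -> X) : subspace_set V ->
  (forall i, V (e i)) -> V (\sum_i e i).
Proof.
move=> hV Ve; apply: (big_ind V) => //; first by case: hV.
by move=> x y; exact: subspaceD.
Qed.

Lemma subspaceT : subspace_set (setT : set X). Proof. by []. Qed.

Lemma subspace0 : subspace_set ([set 0] : set X).
Proof. by split=> // a u v /= -> ->; rewrite scaler0 addr0. Qed.

Lemma subspaceI V W : subspace_set V -> subspace_set W ->
  subspace_set (V `&` W).
Proof.
move=> [V0 hV] [W0 hW]; split=> // a u v [Vu Wu] [Vv Wv].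
by split; [exact: hV|exact: hW].
Qed.

Definition subspace_add V W : set X := [set v + w | v in V & w in W].

Lemma subspace_addP V W : subspace_set V -> subspace_set W ->
  subspace_set (subspace_add V W).
Proof.
move=> [V0 hV] [W0 hW]; split.
  by exists 0 => //; exists 0; rewrite ?addr0.
move=> a _ _ [v Vv [w Ww <-]] [v' Vv' [w' Ww' <-]].
exists (a *: v + v'); first exact: hV.
exists (a *: w + w'); first exact: hW.
by rewrite scalerDr addrACA.
Qed.

End Subspaces.

(** Turning the predicate [linear] into a bundled linear map gives access to
    the rewriting rules of linear maps. *)
Lemma linear_bundle (K : numFieldType) (X Y : normedModType K) (T : X -> Y) :
  linear T -> exists L : {linear X -> Y}, T = L.
Proof.
move=> hT; pose m := GRing.isLinear.Build K X Y _ T hT.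
by exists (HB.pack_for {linear X -> Y} T m).
Qed.

Section LinearImages.
Variables (K : numFieldType) (X Y : normedModType K).

Lemma subspace_image (T : X -> Y) (V : set X) : linear T -> subspace_set V ->
  subspace_set (T @` V).
Proof.
move=> /linear_bundle[L ->] [V0 hV]; split; first by exists 0; rewrite ?linear0.
move=> a _ _ [u Vu <-] [v Vv <-]; exists (a *: u + v); first exact: hV.
by rewrite linearP.
Qed.

Lemma subspace_preimage (T : X -> Y) (W : set Y) : linear T ->
  subspace_set W -> subspace_set [set x | W (T x)].
Proof.
move=> /linear_bundle[L ->] [W0 hW]; split; rewrite /= ?linear0//.
by move=> a u v Wu Wv; rewrite linearP; exact: hW.
Qed.

Lemma subspace_ker (T : X -> Y) : linear T -> subspace_set [set x | T x = 0].
Proof. by move=> hT; exact: (subspace_preimage hT (@subspace0 _ _)). Qed.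

End LinearImages.

Section QuotientDimension.
Variable K : numFieldType.

Section Combinations.
Variable X : normedModType K.
Implicit Types V W A : set X.

Definition lincomb n (e : 'I_n -> X) (c : 'rV[K]_n) : X :=
  \sum_i c 0 i *: e i.

Lemma lincombD n (e : 'I_n -> X) c d :
  lincomb e (c + d) = lincomb e c + lincomb e d.
Proof.
by rewrite /lincomb -big_split; apply: eq_bigr => i _; rewrite mxE scalerDl.
Qed.

Lemma lincombZ n (e : 'I_n -> X) a c : lincomb e (a *: c) = a *: lincomb e c.
Proof.
by rewrite /lincomb scaler_sumr; apply: eq_bigr => i _; rewrite mxE scalerA.
Qed.

Lemma lincombB n (e : 'I_n -> X) c d :
  lincomb e (c - d) = lincomb e c - lincomb e d.
Proof. by rewrite -scaleN1r lincombD lincombZ scaleN1r. Qed.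

Lemma lincomb0 n (e : 'I_n -> X) : lincomb e 0 = 0.
Proof. by rewrite /lincomb big1// => i _; rewrite mxE scale0r. Qed.

Lemma lincomb_mul m n (e : 'I_n -> X) (M : 'M[K]_(m, n)) d :
  lincomb (fun k => lincomb e (row k M)) d = lincomb e (d *m M).
Proof.
rewrite /lincomb; under eq_bigr do rewrite scaler_sumr.
rewrite exchange_big; apply: eq_bigr => i _; rewrite mxE scaler_suml.
by apply: eq_bigr => j _; rewrite mxE scalerA.
Qed.

Lemma lincomb_row_mx m n (e : 'I_m -> X) (f : 'I_n -> X) c d :
  lincomb (fun k => match fintype.split k with inl i => e i | inr j => f j end)
    (row_mx c d) = lincomb e c + lincomb f d.
Proof.
rewrite /lincomb big_split_ord; congr (_ + _); apply: eq_bigr => i _.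
  by rewrite row_mxEl (unsplitK (inl i)).
by rewrite row_mxEr (unsplitK (inr i)).
Qed.

Lemma subspace_lincomb V n (e : 'I_n -> X) c : subspace_set V ->
  (forall i, V (e i)) -> V (lincomb e c).
Proof. by move=> hV Ve; apply: subspace_sum => // i; exact: subspaceZ. Qed.

Lemma quotient_dimP V W n : subspace_set V -> subspace_set W ->
  quotient_dim V W n <-> exists e : 'I_n -> X,
    [/\ forall i, V (e i), forall v, V v -> exists c, W (v - lincomb e c)
      & forall c, W (lincomb e c) -> c = 0].
Proof.
move=> hV hW; split=> [[e [Ve he]]|[e [Ve he h0]]]; exists e; split=> //.
- move=> v /he [c [hc _]]; exists (\row_i c i); rewrite /lincomb.
  by under eq_bigr do rewrite mxE.
- move=> c Wc; have [d [_ hd]] := he 0 hV.1.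
  have d0 : d = fun=> 0.
    apply: hd; rewrite big1 ?subr0; first exact: hW.1.
    by move=> i _; rewrite scale0r.
  have dc : d = c 0 by apply: hd; rewrite sub0r; exact: subspaceN.
  by apply/rowP => i; rewrite -dc d0 mxE.
- move=> v /he [c hc]; exists (c 0); split => // d hd.
  pose d' := \row_i d i.
  have dd' : lincomb e d' = \sum_i d i *: e i.
    by apply: eq_bigr => i _; rewrite mxE.
  have /h0/eqP : W (lincomb e (d' - c)).
    rewrite lincombB dd' [X in W X](_ : _ = (v - lincomb e c) -
       (v - \sum_i d i *: e i)); first exact: subspaceB.
    by rewrite opprB [RHS]addrC addrA subrK.
  rewrite subr_eq0 => /eqP d'c; apply/funext => i.
  by rewrite -d'c mxE.
Qed.

Lemma quotient_dim_le V W n m : subspace_set V -> subspace_set W ->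
  quotient_dim V W n -> quotient_dim V W m -> (n <= m)%N.
Proof.
move=> hV hW /(quotient_dimP _ hV hW)[e [Ve _ e0]].
move=> /(quotient_dimP _ hV hW)[f [_ fs _]].
pose M := \matrix_(i < n) projT1 (cid (fs _ (Ve i))).
have hM i : W (e i - lincomb f (row i M)).
  by rewrite rowK; case: cid.
have eM c : W (lincomb e c - lincomb f (c *m M)).
  rewrite -lincomb_mul /lincomb -sumrB; apply: subspace_sum => // i.
  by rewrite -scalerBr; exact: subspaceZ.
have kM0 : kermx M = 0.
  apply/row_matrixP => i; rewrite row0; apply: e0.
  have := eM (row i (kermx M)).
  by rewrite -row_mul mulmx_ker row0 lincomb0 subr0.
have := mxrank_ker M; rewrite kM0 mxrank0 => /esym/eqP; rewrite subn_eq0.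
by move=> /leq_trans; apply; exact: rank_leq_col.
Qed.

Lemma quotient_dim_uniq V W n m : subspace_set V -> subspace_set W ->
  quotient_dim V W n -> quotient_dim V W m -> n = m.
Proof.
by move=> hV hW Hn Hm; apply/eqP; rewrite eqn_leq !(quotient_dim_le hV hW).
Qed.

Lemma quotient_dim_cat V A W n m : subspace_set V -> subspace_set A ->
  subspace_set W -> A `<=` V -> W `<=` A -> quotient_dim A W n ->
  quotient_dim V A m -> quotient_dim V W (n + m).
Proof.
move=> hV hA hW AV WA /(quotient_dimP _ hA hW)[e [Ae es e0]].
move=> /(quotient_dimP _ hV hA)[f [Vf fs f0]].
apply/(quotient_dimP _ hV hW).
exists (fun k => match fintype.split k with inl i => e i | inr j => f j end).
split.
- by move=> k; case: fintype.split => i; [exact/AV/Ae|exact: Vf].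
- move=> v /fs [d /es [c hc]]; exists (row_mx c d).
  by rewrite lincomb_row_mx opprD addrA addrAC.
- move=> c; rewrite -[c]hsubmxK lincomb_row_mx => Wc.
  have d0 : rsubmx c = 0.
    apply: f0; rewrite -[lincomb f _](addKr (lincomb e (lsubmx c))) addrC.
    apply: subspaceB => //; first exact: WA.
    exact: subspace_lincomb.
  by rewrite d0 lincomb0 addr0 in Wc *; rewrite (e0 _ Wc) row_mx0.
Qed.

(** In coordinates modulo [W], the intermediate space [A] is a subspace of
    [K^n]; a matrix of maximal rank among those with rows in it spans it, and
    row bases of this matrix and of a complement give the two bases. *)
Lemma quotient_dim_split V A W n : subspace_set V -> subspace_set A ->
  subspace_set W -> A `<=` V -> W `<=` A -> quotient_dim V W n ->
  exists r s, [/\ (r + s)%N = n, quotient_dim A W r & quotient_dim V A s].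
Proof.
move=> hV hA hW AV WA /(quotient_dimP _ hV hW)[e [Ve es e0]].
pose inA (M : 'M[K]_n) := forall c, (c <= M)%MS -> A (lincomb e c).
have [M [MA Mmax]] : exists M, inA M /\
    forall c, A (lincomb e c) -> (c <= M)%MS.
  have bnd r : `[< exists M, inA M /\ \rank M = r >] -> (r <= n)%N.
    by move=> /asboolP[M [_ <-]]; exact: rank_leq_col.
  have ex : exists r, `[< exists M, inA M /\ \rank M = r >].
    exists 0%N; apply/asboolP; exists 0; split; last by rewrite mxrank0.
    by move=> c; rewrite submx0 => /eqP ->; rewrite lincomb0; exact: hA.1.
  case: (ex_maxnP ex bnd) => r /asboolP[M [MA Mr]] rmax.
  exists M; split=> // c Ac.
  have : (\rank (M + c)%MS <= r)%N.
    apply: rmax; apply/asboolP; exists (M + c)%MS; split=> // d.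
    move=> /sub_addsmxP[[u v] ->] /=; rewrite lincombD; apply: subspaceD => //.
      by apply: MA; exact: submxMl.
    by rewrite [v]mx11_scalar mul_scalar_mx lincombZ; exact: subspaceZ.
  rewrite -Mr => rk.
  have /eqmxP/eqmx_sym/eqmxP : (M == M + c)%MS.
    by rewrite -(geq_leqif (mxrank_leqif_eq (addsmxSl _ _))).
  by move=> /andP[+ _]; apply: submx_trans; exact: addsmxSr.
pose B := row_base M; pose C := row_base (M^C)%MS.
have BM : (B :=: M)%MS by exact: eq_row_base.
have CM : (C :=: M^C)%MS by exact: eq_row_base.
exists (\rank M), (\rank (M^C)%MS); split.
- by rewrite mxrank_compl subnKC// rank_leq_col.
- apply/(quotient_dimP _ hA hW); exists (fun k => lincomb e (row k B)); split.
  + by move=> k; apply: MA; rewrite -BM; exact: row_sub.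
  + move=> v Av; have [c hc] := es v (AV _ Av).
    have : (c <= B)%MS.
      rewrite BM; apply: Mmax; rewrite -[lincomb e c](subKr v).
      by apply: subspaceB => //; exact: WA.
    by move=> /submxP[d cd]; exists d; rewrite lincomb_mul -cd.
  + move=> d; rewrite lincomb_mul => /e0 /eqP.
    by rewrite mulmx_free_eq0 ?row_base_free// => /eqP.
- apply/(quotient_dimP _ hV hA); exists (fun k => lincomb e (row k C)); split.
  + by move=> k; exact: subspace_lincomb.
  + move=> v Vv; have [c hc] := es v Vv.
    have : (c <= M + M^C)%MS by apply/submx_full/addsmx_compl_full.
    rewrite -(adds_eqmx BM CM) => /sub_addsmxP[[u d] /= cE]; exists d.
    rewrite lincomb_mul.
    have -> : v - lincomb e (d *m C) = (v - lincomb e c) + lincomb e (u *m B).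
      by rewrite cE lincombD [- (_ + _)]opprD addrA [RHS]addrAC subrK.
    apply: subspaceD => //; first exact: WA.
    by apply: MA; rewrite -BM; exact: submxMl.
  + move=> d; rewrite lincomb_mul => /Mmax dM.
    have : (d *m C <= M :&: M^C)%MS.
      by rewrite sub_capmx dM -CM submxMl.
    rewrite capmx_compl submx0 mulmx_free_eq0 ?row_base_free//.
    by move=> /eqP.
Qed.

End Combinations.

Lemma linear_lincomb (X Y : normedModType K) (T : X -> Y) n (e : 'I_n -> X) c :
  linear T -> T (lincomb e c) = lincomb (T \o e) c.
Proof.
move=> /linear_bundle[L ->]; rewrite linear_sum; apply: eq_bigr => i _.
by rewrite linearZ.
Qed.

Section Transfer.
Variables (X Y : normedModType K) (T : X -> Y).
Variables (V W : set X) (V' W' : set Y).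
Hypotheses (hV : subspace_set V) (hW : subspace_set W).
Hypotheses (hV' : subspace_set V') (hW' : subspace_set W').
Hypotheses (linT : linear T) (TV : forall v, V v -> V' (T v)).
Hypothesis surjT : forall v', V' v' -> exists2 v, V v & W' (v' - T v).
Hypothesis injT : forall v, V v -> (W v <-> W' (T v)).

(** Together, [TV], [surjT] and [injT] say that [T] induces a bijection of
    V / W onto V' / W'. *)
Lemma quotient_dim_image n : quotient_dim V W n -> quotient_dim V' W' n.
Proof.
move=> /(quotient_dimP _ hV hW)[e [Ve es e0]].
apply/(quotient_dimP _ hV' hW'); exists (T \o e); split.
- by move=> i; exact/TV/Ve.
- move=> v' /surjT[v Vv v'v]; have [c hc] := es v Vv; exists c.
  rewrite -(subrK (T v) v') -addrA; apply: subspaceD => //.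
  have [L TL] := linear_bundle linT.
  rewrite -linear_lincomb// TL -linearB -TL; apply/injT => //.
  by apply: subspaceB => //; exact: subspace_lincomb.
- move=> c; rewrite -linear_lincomb// => /injT h; apply/e0/h.
  exact: subspace_lincomb.
Qed.

Lemma quotient_dim_preimage n : quotient_dim V' W' n -> quotient_dim V W n.
Proof.
move=> /(quotient_dimP _ hV' hW')[f [Vf fs f0]].
have [L TL] := linear_bundle linT.
pose e i := projT1 (cid2 (surjT (Vf i))).
have Ve i : V (e i) by rewrite /e; case: cid2.
have fe i : W' (f i - T (e i)) by rewrite /e; case: cid2.
have fTe c : W' (lincomb f c - T (lincomb e c)).
  rewrite linear_lincomb// /lincomb -sumrB; apply: subspace_sum => // i.
  by rewrite -scalerBr; exact: subspaceZ.
apply/(quotient_dimP _ hV hW); exists e; split=> //.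
- move=> v Vv; have [c hc] := fs _ (TV Vv); exists c.
  apply/injT; first by apply: subspaceB => //; exact: subspace_lincomb.
  rewrite TL linearB -TL -(subrK (lincomb f c) (T v)) -addrA.
  exact: subspaceD.
- move=> c We; apply: f0; rewrite -(subrK (T (lincomb e c)) (lincomb f c)).
  apply: subspaceD => //; apply/injT => //.
  exact: subspace_lincomb.
Qed.

End Transfer.

End QuotientDimension.

(** * The Fredholm index *)

Section FredholmIndex.
Variable K : numFieldType.

(** Additivity of the index, read off the exact sequence
    0 -> ker S -> ker TS -> ker T -> coker S -> coker TS -> coker T -> 0.
    The kernel and the cokernel of [S] are finite-dimensional here because
    those of [T] and of [T S] are. *)
Lemma index_comp (X Y Z : normedModType K) (S : X -> Y) (T : Y -> Z)
    (V : set Y) n m p q :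
  linear S -> linear T -> subspace_set V -> (forall x, V (S x)) ->
  quotient_dim (V `&` [set y | T y = 0]) [set 0] n ->
  quotient_dim setT (T @` V) m ->
  quotient_dim [set x | T (S x) = 0] [set 0] p ->
  quotient_dim setT (range (T \o S)) q ->
  exists kS cS, [/\ quotient_dim [set x | S x = 0] [set 0] kS,
    quotient_dim V (range S) cS & (p + m + cS = q + n + kS)%N].
Proof.
move=> linS linT hV SV Qn Qm Qp Qq.
have [LS eS] := linear_bundle linS; have [LT eT] := linear_bundle linT.
have linTS : linear (T \o S) by move=> a u v; rewrite /= linS linT.
have h0 (W : normedModType K) := @subspace0 K W.
have hT (W : normedModType K) := @subspaceT K W.
have hkS := subspace_ker linS; have hkTS := subspace_ker linTS.
have hkT : subspace_set (V `&` [set y | T y = 0]).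
  by apply: subspaceI => //; exact: subspace_ker.
have hrS := subspace_image linS (hT X).
have hrTS := subspace_image linTS (hT X).
have hTV := subspace_image linT hV.
pose A := range S `&` [set y | T y = 0].
have hA : subspace_set A by apply: subspaceI => //; exact: subspace_ker.
pose B := subspace_add (range S) (V `&` [set y | T y = 0]).
have hB : subspace_set B by exact: subspace_addP.
have BV : B `<=` V.
  by move=> _ [_ [x _ <-] [y [Vy _] <-]]; exact: subspaceD.
have SB : range S `<=` B.
  by move=> y Sy; exists y => //; exists 0; rewrite ?addr0//; exact: hkT.1.
(* ker TS / ker S is the image under S, which is ran S & ker T *)
have [kS [a [pE QkS Qa]]] : exists r s, [/\ (r + s)%N = p,
    quotient_dim [set x | S x = 0] [set 0] r &
    quotient_dim [set x | T (S x) = 0] [set x | S x = 0] s].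
  apply: quotient_dim_split => //.
    by move=> x /= ->; rewrite eT linear0.
  by move=> x /= ->; rewrite eS linear0.
have {}QA : quotient_dim A [set 0] a.
  apply: (quotient_dim_image hkTS hkS hA (h0 Y) linS) Qa => //.
  by move=> _ [[x _ <-] /= TSx]; exists x; rewrite ?subrr.
(* ker T / (ran S & ker T) = (ran S + ker T) / ran S *)
have [a' [c [nE Qa' Qc]]] : exists r s, [/\ (r + s)%N = n,
    quotient_dim A [set 0] r & quotient_dim (V `&` [set y | T y = 0]) A s].
  apply: quotient_dim_split => //; last by move=> _ ->; exact: hA.1.
  by move=> _ [[x _ <-] TSx]; split.
have a'E : a' = a by apply: quotient_dim_uniq Qa' QA.
have {}Qc : quotient_dim B (range S) c.
  apply: (quotient_dim_image (T := idfun) hkT hA hB hrS) Qc => //.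
  - by move=> y hy; exists 0; [exact: hrS.1|exists y; rewrite ?add0r].
  - by move=> _ [_ [x _ <-] [y hy <-]]; exists y => //; exists x => //=;
      rewrite addrK.
  - by move=> y [Vy Ty]; split=> [[]|].
(* ran T / ran TS = V / (ran S + ker T) *)
have [b [m' [qE Qb Qm']]] : exists r s, [/\ (r + s)%N = q,
    quotient_dim (T @` V) (range (T \o S)) r & quotient_dim setT (T @` V) s].
  by apply: quotient_dim_split => // _ [x _ <-]; exists (S x).
have m'E : m' = m by apply: quotient_dim_uniq Qm' Qm.
have {}Qb : quotient_dim V B b.
  apply: (quotient_dim_preimage hV hB hTV hrTS linT) Qb => //.
  - by move=> _ [v Vv <-]; exists v => //; rewrite subrr; exact: hrTS.1.
  - move=> v Vv; split=> [[_ [x _ <-] [y [Vy Ty] <-]]|[x _ /= TSx]].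
      by exists x => //=; rewrite [in RHS]eT linearD -eT Ty addr0.
    exists (S x); first by exists x.
    exists (v - S x); last by rewrite addrC subrK.
    split; first exact: subspaceB.
    by rewrite /= eT linearB -eT TSx subrr.
exists kS, (c + b)%N; split=> //; first exact: (quotient_dim_cat hV hB hrS).
by lia.
Qed.

(** The space is the direct sum of ker T^N and ran T^N, and [T] is bijective
    on ran T^N; hence its index is that of its restriction to the
    finite-dimensional space ker T^N, which is 0. *)
Lemma stationary_index0 (X : normedModType K) (T : X -> X) N d :
  linear T -> (0 < N)%N ->
  (forall x, iter N.+1 T x = 0 -> iter N T x = 0) ->
  (forall x, exists y, iter N T x = iter N.+1 T y) ->
  quotient_dim [set x | iter N T x = 0] [set 0] d ->
  exists n, quotient_dim [set x | T x = 0] [set 0] n /\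
    quotient_dim setT (range T) n.
Proof.
move=> linT N0 kerN ranN Qd.
have [L TL] := linear_bundle linT.
have T0 j : iter j T 0 = 0 by elim: j => //= j ->; rewrite TL linear0.
have linTN : linear (iter N T).
  by elim: (N) => [//|j IH] a u v; rewrite !iterS IH linT.
pose M := [set x | iter N T x = 0].
have hM : subspace_set M := subspace_ker linTN.
have h0 := @subspace0 K X; have hT := @subspaceT K X.
have hk := subspace_ker linT; have hTM := subspace_image linT hM.
have hr := subspace_image linT hT.
have kM : [set x | T x = 0] `<=` M.
  by move=> x /= Tx; rewrite /M /= -(prednK N0) iterSr Tx T0.
have TMM : T @` M `<=` M.
  by move=> _ [x Mx <-]; rewrite /M /= -iterSr iterS Mx TL linear0.
have [n [s [dE Qn Qs]]] : exists r s, [/\ (r + s)%N = d,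
    quotient_dim [set x | T x = 0] [set 0] r &
    quotient_dim M [set x | T x = 0] s].
  by apply: quotient_dim_split => // x ->; exact: hk.1.
exists n; split=> //.
have {}Qs : quotient_dim (T @` M) [set 0] s.
  apply: (quotient_dim_image hM hk hTM h0 linT) Qs => //.
  by move=> _ [x Mx <-]; exists x; rewrite ?subrr.
have [s' [n' [dE' Qs' Qn']]] : exists r s, [/\ (r + s)%N = d,
    quotient_dim (T @` M) [set 0] r & quotient_dim M (T @` M) s].
  by apply: quotient_dim_split => // x ->; exact: hTM.1.
have s'E : s' = s by apply: quotient_dim_uniq Qs' Qs.
have n'E : n' = n by lia.
rewrite -n'E.
apply: (quotient_dim_image (T := idfun) hM hTM hT hr) Qn' => //.
- move=> x _; have [y xy] := ranN x; exists (x - T y).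
    have [LN eN] := linear_bundle linTN.
    by rewrite /M /= eN linearB -eN xy -iterSr subrr.
  by exists y => //=; rewrite opprB addrC subrK.
- move=> x Mx; split=> [[y _ <-]|[y _ yx]]; first by exists y.
  by exists y => //; apply: kerN; rewrite iterSr yx.
Qed.

End FredholmIndex.

(** * Bounded and compact operators *)

Section BoundedOperators.
Variable K : numFieldType.

Lemma gt0_norm_ltNge (X : normedModType K) (x : X) (a : K) : 0 < a ->
  (`|x| < a) = ~~ (a <= `|x|).
Proof. by move=> a0; rewrite real_ltNge ?normr_real ?gtr0_real. Qed.

Lemma bounded_op_opnorm (X Y : normedModType K) (T : X -> Y) :
  bounded_op T -> exists2 M : K, 0 < M & opnorm_le T M.
Proof.
move=> [/linear_bundle[L ->] cL].
have /cvg_ballP/(_ 1 ltr01) := cL 0.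
rewrite linear0 => /nbhs_ballP[d /= d0 hd].
exists (2 / d); first by rewrite divr_gt0.
move=> x; have [->|x0] := eqVneq x 0; first by rewrite linear0 !normr0 mulr0.
have nx0 : 0 < `|x| by rewrite normr_gt0.
pose a := d / (2 * `|x|).
have a0 : 0 < a by rewrite divr_gt0// mulr_gt0.
have : ball (0 : X) d (a *: x).
  rewrite -ball_normE /= sub0r normrN normrZ gtr0_norm//.
  have -> : a * `|x| = d / 2 by rewrite /a; field; rewrite gt_eqF.
  by rewrite ltr_pdivrMr// mulr_natr mulr2n ltrDl.
move=> /hd; rewrite -ball_normE /= sub0r normrN linearZ normrZ gtr0_norm//.
rewrite -ltr_pdivlMl// mulr1 => /ltW.
by have -> : a^-1 = 2 / d * `|x| by rewrite /a; field; rewrite !gt_eqF.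
Qed.

Lemma norm_fst_le (X Y : normedModType K) (p : X * Y) : `|p.1| <= `|p|.
Proof.
by rewrite prod_normE comparable_le_max ?lexx// real_comparable ?normr_real.
Qed.

Lemma norm_snd_le (X Y : normedModType K) (p : X * Y) : `|p.2| <= `|p|.
Proof.
rewrite prod_normE comparable_le_max ?lexx ?orbT//.
by rewrite real_comparable ?normr_real.
Qed.

Lemma norm_pair_le (X Y : normedModType K) (p : X * Y) (M : K) :
  `|p.1| <= M -> `|p.2| <= M -> `|p| <= M.
Proof. by rewrite prod_normE /Order.max; case: ifP. Qed.

Lemma norm_pair_lt (X Y : normedModType K) (p : X * Y) (M : K) :
  `|p.1| < M -> `|p.2| < M -> `|p| < M.
Proof. by rewrite prod_normE /Order.max; case: ifP. Qed.

End BoundedOperators.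

(** Compactness of an operator in metric form: over a complete target it says
    that the image of the unit ball is relatively compact, and in this form
    the closure properties of compact operators are estimates. *)
Definition totally_bounded_op (K : numFieldType) (X Y : normedModType K)
    (T : X -> Y) :=
  forall e : K, 0 < e -> exists s : seq Y, forall x, `|x| <= 1 ->
    exists2 y, y \in s & `|T x - y| < e.

Section TotallyBoundedOperators.
Variable K : numFieldType.
Implicit Types X Y Z : normedModType K.

Lemma compact_totally_bounded X Y (T : X -> Y) :
  compact_op T -> totally_bounded_op T.
Proof.
move=> [_]; rewrite precompactE compact_cover => cT e e0.
have [|y _|D _ DT] := cT Y setT (fun y => ball y e).
- by move=> y _; exact: ball_open.
- by exists y => //; exact: ballxx.
exists (finmap.enum_fset D) => x x1.
have /DT[y /= yD] : closure (T @` [set x | `|x| <= 1]) (T x).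
  by apply: subset_closure; exists x.
by rewrite -ball_normE /= distrC => h; exists y.
Qed.

Lemma totally_boundedD X Y (S T : X -> Y) :
  totally_bounded_op S -> totally_bounded_op T -> totally_bounded_op (S + T).
Proof.
move=> hS hT e e0; have e2 : 0 < e / 2 by rewrite divr_gt0.
have [s hs] := hS _ e2; have [t ht] := hT _ e2.
exists [seq y + z | y <- s, z <- t] => x x1.
have [y ys xy] := hs x x1; have [z zt xz] := ht x x1.
exists (y + z); first exact: allpairs_f.
rewrite /= opprD addrACA (le_lt_trans (ler_normD _ _))//.
by rewrite (splitr e) ltrD.
Qed.

Lemma totally_bounded_compl X Y Z (L : Y -> Z) (T : X -> Y) : linear L ->
  (exists2 M, 0 < M & opnorm_le L M) ->
  totally_bounded_op T -> totally_bounded_op (L \o T).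
Proof.
move=> /linear_bundle[L' ->] [M M0 hM] hT e e0.
have [|s hs] := hT (e / M); first by rewrite divr_gt0.
exists [seq L' y | y <- s] => x /hs[y ys xy].
exists (L' y); first exact: map_f.
rewrite /= -linearB (le_lt_trans (hM _))//.
by rewrite mulrC -ltr_pdivlMr.
Qed.

Lemma totally_bounded_compr X Y Z (T : Y -> Z) (L : X -> Y) : linear T ->
  (exists2 M, 0 < M & opnorm_le L M) ->
  totally_bounded_op T -> totally_bounded_op (T \o L).
Proof.
move=> /linear_bundle[T' ->] [M M0 hM] hT e e0.
have [|s hs] := hT (e / M); first by rewrite divr_gt0.
exists [seq M *: y | y <- s] => x x1.
have /hs[y ys xy] : `|M^-1 *: L x| <= 1.
  rewrite normrZ gtr0_norm ?invr_gt0// ler_pdivrMl// mulr1.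
  by rewrite (le_trans (hM x))// ler_piMr// ltW.
exists (M *: y); first exact: map_f.
have -> : (T' \o L) x - M *: y = M *: (T' (M^-1 *: L x) - y).
  by rewrite scalerBr -[M *: T' _]linearZ scalerA divff ?gt_eqF// scale1r.
by rewrite normrZ gtr0_norm// mulrC -ltr_pdivlMr.
Qed.

Lemma totally_boundedN X Y (T : X -> Y) :
  totally_bounded_op T -> totally_bounded_op (- T).
Proof.
move=> hT e /hT[s hs]; exists [seq - y | y <- s] => x /hs[y ys xy].
by exists (- y); [exact: map_f|rewrite /= -opprD normrN].
Qed.

Lemma totally_boundedB X Y (S T : X -> Y) :
  totally_bounded_op S -> totally_bounded_op T -> totally_bounded_op (S - T).
Proof.
by move=> hS hT; apply: totally_boundedD => //; exact: totally_boundedN.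
Qed.

Lemma totally_bounded_approx X Y (T : X -> Y) :
  (forall e, 0 < e -> exists2 S, totally_bounded_op S & opnorm_le (T - S) e) ->
  totally_bounded_op T.
Proof.
move=> hT e e0; have e2 : 0 < e / 2 by rewrite divr_gt0.
have [S hS TS] := hT _ e2; have [s hs] := hS _ e2; exists s => x x1.
have [y ys xy] := hs x x1; exists y => //.
have -> : T x - y = (T - S) x + (S x - y) by rewrite /= addrA subrK.
rewrite (le_lt_trans (ler_normD _ _))// (splitr e) ler_ltD//.
by rewrite (le_trans (TS x))// ler_piMr// ltW.
Qed.

End TotallyBoundedOperators.

(** * The Riesz lemma *)

Section RieszLemma.
Variable K : numFieldType.

Definition archimedean := forall a : K, 0 <= a -> exists n : nat, a < n%:R.

Lemma closed_dist (X : normedModType K) (V : set X) x : closed V -> ~ V x ->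
  exists2 d : K, 0 < d & forall v, V v -> d <= `|x - v|.
Proof.
move=> cV Vx; have : nbhs x (~` V).
  by apply: open_nbhs_nbhs; split => //; exact: closed_openC.
move=> /nbhs_ballP[d /= d0 hd]; exists d => // v Vv.
apply/negPn; rewrite -gt0_norm_ltNge//; apply/negP => xv.
by apply: (hd v) => //; rewrite -ball_normE.
Qed.

(** Instead of approaching the infimum of the distances from [x] to [V], halve
    the scale as long as some distance is smaller. *)
Lemma riesz_lemma (X : normedModType K) (V : set X) x : archimedean ->
  subspace_set V -> closed V -> ~ V x ->
  exists s v, [/\ 0 < s, V v, `|s *: (x - v)| <= 1
    & forall w, V w -> 2^-1 <= `|s *: (x - v) - w|].
Proof.
move=> hK hV cV Vx; have [d d0 hd] := closed_dist cV Vx.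
have ex : exists j, `[< exists2 v, V v & `|x - v| < 2 ^+ j * d >].
  have [n hn] : exists n : nat, `|x| / d < n%:R.
    by apply: hK; rewrite divr_ge0// ltW.
  exists n; apply/asboolP; exists 0; first exact: hV.1.
  rewrite subr0 -ltr_pdivrMr// (lt_le_trans hn)// -natrX ler_nat.
  exact/ltnW/ltn_expl.
case: (ex_minnP ex) => -[|j] /asboolP[v Vv xv] jmin.
  have := lt_le_trans xv (_ : _ <= _); rewrite expr0 mul1r => /(_ _ (hd _ Vv)).
  by rewrite ltxx.
have c0 : 0 < 2 ^+ j.+1 * d by rewrite mulr_gt0// exprn_gt0.
exists (2 ^+ j.+1 * d)^-1, v; split=> //; first by rewrite invr_gt0.
  by rewrite normrZ gtr0_norm ?invr_gt0// ler_pdivrMl// mulr1 ltW.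
move=> w Vw; set c := 2 ^+ j.+1 * d.
have -> : c^-1 *: (x - v) - w = c^-1 *: (x - (v + c *: w)).
  by rewrite opprD addrA [RHS]scalerBr scalerA mulVf ?gt_eqF// scale1r.
rewrite normrZ gtr0_norm ?invr_gt0// ler_pdivlMl//.
have -> : c / 2 = 2 ^+ j * d by rewrite /c exprS; field.
have cj : 0 < 2 ^+ j * d by rewrite mulr_gt0// exprn_gt0.
apply/negPn; rewrite -gt0_norm_ltNge//; apply/negP => h.
suff /jmin : `[< exists2 v, V v & `|x - v| < 2 ^+ j * d >] by rewrite ltnn.
apply/asboolP; exists (v + c *: w) => //.
by apply: subspaceD => //; exact: subspaceZ.
Qed.

(** In a strictly increasing chain, the Riesz lemma gives vectors of the unit
    ball whose images under [k] are far apart. *)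
Lemma riesz_chain (X : normedModType K) (k : X -> X) : archimedean ->
  linear k -> totally_bounded_op k -> exists N, forall V : nat -> set X,
  (forall j, subspace_set (V j) /\ closed (V j)) ->
  (forall j, (j < N)%N ->
     V j `<=` V j.+1 /\ forall x, V j.+1 x -> V j (x - k x)) ->
  exists2 j, (j < N)%N & V j.+1 `<=` V j.
Proof.
(* two points at distance less than 1/4 from a third one are at distance less
   than 1/2 from each other *)
move=> hK link hk; have [|s hs] := hk (4^-1); first by rewrite invr_gt0.
exists (size s).+1 => V hV chainV; apply: contrapT => nV.
have [Lk Ek] := linear_bundle link.
have hx (j : 'I_(size s).+1) : exists x, [/\ V j.+1 x, `|x| <= 1 &
    forall w, V j w -> 2^-1 <= `|x - w|].
  have [x Vx nVx] : exists2 x, V j.+1 x & ~ V j x.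
    apply: contrapT => h; apply: nV; exists j => // x Vx.
    by apply: contrapT => nVx; apply: h; exists x.
  have [c [v [c0 Vv h1 h2]]] := riesz_lemma hK (hV j).1 (hV j).2 nVx.
  exists (c *: (x - v)); split=> //.
  apply: subspaceZ; first exact: (hV j.+1).1.
  apply: subspaceB => //; first exact: (hV j.+1).1.
  exact: (chainV j (ltn_ord j)).1.
have [x xP] := choice hx.
have hi (j : 'I_(size s).+1) : exists i : 'I_(size s), `|k (x j) - s`_i| < 4^-1.
  have [_ x1 _] := xP j; have [y ys h] := hs _ x1.
  by exists (Ordinal (etrans (index_mem y s) ys)); rewrite nth_index.
have [f fP] := choice hi.
have far (i j : 'I_(size s).+1) : (i < j)%N -> f i <> f j.
  move=> ij fij; have [Vi _ _] := xP i; have [Vj _ farj] := xP j.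
  have Vmon n : (n <= j)%N -> (i < n)%N -> V n (x i).
    elim: n => // n IH nj; rewrite ltnS leq_eqVlt => /orP[/eqP <-//|ni].
    have [+ _] := chainV n (leq_trans nj (ltnW (ltn_ord j))).
    by apply; apply: IH => //; exact: ltnW.
  have Vji := Vmon _ (leqnn _) ij.
  have Vkxi : V j (k (x i)).
    have [Vjj1 hj] := chainV j (ltn_ord j).
    rewrite -[k _](subKr (x i)); apply: subspaceB => //; first exact: (hV j).1.
    exact/hj/Vjj1.
  have Vkxj := (chainV j (ltn_ord j)).2 _ Vj.
  have := farj _ (subspaceD (hV j).1 Vkxj Vkxi).
  have -> : x j - (x j - k (x j) + k (x i)) =
      (k (x j) - s`_(f j)) - (k (x i) - s`_(f i)).
    rewrite fij opprB [RHS]addrA subrK opprD opprB addrA.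
    by rewrite [x j + _]addrC subrK.
  move=> /le_lt_trans/(_ (le_lt_trans (ler_normB _ _) (ltrD (fP j) (fP i)))).
  suff -> : 4^-1 + 4^-1 = 2^-1 :> K by rewrite ltxx.
  by field.
have /leq_card : injective f.
  move=> i j fij; apply/val_inj/eqP; rewrite eqn_leq.
  by apply/andP; split; rewrite leqNgt; apply/negP => /far; apply.
by rewrite !card_ord ltnn.
Qed.

End RieszLemma.

(** * Sequential completeness *)

Section Sequences.
Variable K : numFieldType.

Definition seq_limit (X : normedModType K) (u : nat -> X) (l : X) :=
  forall e : K, 0 < e -> exists N, forall n, (N <= n)%N -> `|u n - l| < e.

(** In terms of sequences, completeness passes to products componentwise and
    is used both for the spaces and for the scalars. *)
Definition seq_complete (X : normedModType K) := forall u : nat -> X,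
  (forall e : K, 0 < e -> exists N, forall n, (N <= n)%N -> `|u n - u N| < e) ->
  exists l, seq_limit u l.

Lemma completeNormed_seq_complete (X : completeNormedModType K) :
  seq_complete X.
Proof.
move=> u cu; have : cauchy (u @ \oo).
  apply: cauchy_exP => e e0; have [N hN] := cu e e0.
  exists (u N), N => // n /hN.
  by rewrite -ball_normE /= distrC.
move=> /cauchy_cvg/cvg_ex[l /cvg_ballP ul]; exists l => e /ul[N _ hN].
by exists N => n /hN; rewrite /= -ball_normE /= distrC.
Qed.

Lemma seq_complete_prod (X Y : normedModType K) :
  seq_complete X -> seq_complete Y -> seq_complete (X * Y)%type.
Proof.
move=> cX cY u cu.
have [|l1 h1] := cX (fst \o u).
  move=> e e0; have [N hN] := cu e e0; exists N => n /hN.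
  by apply: le_lt_trans; exact: (norm_fst_le (u n - u N)).
have [|l2 h2] := cY (snd \o u).
  move=> e e0; have [N hN] := cu e e0; exists N => n /hN.
  by apply: le_lt_trans; exact: (norm_snd_le (u n - u N)).
exists (l1, l2) => e e0; have [N1 hN1] := h1 e e0; have [N2 hN2] := h2 e e0.
exists (maxn N1 N2) => n; rewrite geq_max => /andP[/hN1 ? /hN2 ?].
by apply: norm_pair_lt.
Qed.

Lemma norm_small_eq0 (X : normedModType K) (x : X) (M : K) : 0 < M ->
  (forall e, 0 < e -> `|x| <= M * e) -> x = 0.
Proof.
move=> M0 h; apply/eqP; rewrite -normr_eq0; apply: contraT => x0.
have xgt0 : 0 < `|x| by rewrite lt_def x0 normr_ge0.
have M2 : 0 < 2 * M by rewrite mulr_gt0.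
have := h (`|x| / (2 * M)) (divr_gt0 xgt0 M2).
have -> : M * (`|x| / (2 * M)) = `|x| / 2 by field; rewrite gt_eqF.
rewrite ler_pdivlMr// mulr_natr mulr2n gerDl => /(lt_le_trans xgt0).
by rewrite ltxx.
Qed.

Lemma inv_natS_small (e : K) : archimedean K -> 0 < e ->
  exists N, forall n, (N <= n)%N -> n.+1%:R^-1 < e.
Proof.
move=> hK e0; have [|N hN] := hK e^-1; first by rewrite invr_ge0 ltW.
exists N => n Nn; rewrite -[e]invrK ltf_pV2 ?posrE ?invr_gt0 ?ltr0n//.
by rewrite (lt_le_trans hN)// ler_nat leqW.
Qed.

Lemma closed_approx (X : normedModType K) (V : set X) :
  (forall y, (forall e : K, 0 < e -> exists2 v, V v & `|y - v| < e) -> V y) <->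
  closed V.
Proof.
split=> [h y cy|cV y hy].
  apply: h => e e0; have [v [Vv]] := cy _ (nbhsx_ballx y e e0).
  by rewrite -ball_normE; exists v.
apply: cV => B /nbhs_ballP[e /= e0 eB]; have [v Vv yv] := hy e e0.
by exists v; split => //; apply: eB; rewrite -ball_normE.
Qed.

(** Over a complete field a closed subspace stays closed when a line is
    added: a Cauchy sequence of coefficients is controlled by the distance of
    the line to the subspace. *)
Lemma closed_add_line (X : normedModType K) (V : set X) x :
  archimedean K -> seq_complete K^o -> subspace_set V -> closed V ->
  closed (subspace_add V [set a *: x | a in setT]).
Proof.
move=> hK cK hV cV; have [Vx|nVx] := pselect (V x).
  rewrite (_ : subspace_add _ _ = V)//; apply/seteqP; split=> y.
    move=> [v Vv [_ [a _ <-] <-]]; apply: subspaceD => //; exact: subspaceZ.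
  move=> Vy; exists y => //; exists 0; rewrite ?addr0//.
  by exists 0; rewrite ?scale0r.
have [d d0 hd] := closed_dist cV nVx.
apply/closed_approx => y hy.
have /choice[cv hcv] : forall n : nat, exists cv : K * X,
    V cv.2 /\ `|y - (cv.2 + cv.1 *: x)| < n.+1%:R^-1.
  move=> n; have [|_ [v Vv [_ [c _ <-] <-]] h] := hy n.+1%:R^-1.
    by rewrite invr_gt0 ltr0n.
  by exists (c, v).
have coeff c v : V v -> `|c| * d <= `|v + c *: x|.
  move=> Vv; have [->|c0] := eqVneq c 0; first by rewrite normr0 mul0r.
  have -> : v + c *: x = c *: (x - (- c^-1 *: v)).
    by rewrite scalerBr scaleNr scalerN opprK scalerA divff// scale1r addrC.
  rewrite normrZ ler_pM2l ?normr_gt0//; apply: hd; exact: subspaceZ.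
have [|c hc] := cK (fun n => (cv n).1).
  move=> e e0; have [|N hN] := @inv_natS_small (e * d / 2) hK.
    by rewrite divr_gt0// mulr_gt0.
  exists N => n Nn; rewrite -(ltr_pM2r d0).
  have [Vn yn] := hcv n; have [VN yN] := hcv N.
  apply: le_lt_trans (coeff _ _ (subspaceB hV Vn VN)) _.
  have -> : (cv n).2 - (cv N).2 + ((cv n).1 - (cv N).1) *: x =
      (y - ((cv N).2 + (cv N).1 *: x)) - (y - ((cv n).2 + (cv n).1 *: x)).
    rewrite [- (y - ((cv n).2 + _))]opprB [RHS]addrC addrA subrK.
    by rewrite opprD addrACA scalerBl.
  rewrite (le_lt_trans (ler_normB _ _))// (splitr (e * d)) ltrD//.
    by rewrite (lt_trans yN)// hN.
  by rewrite (lt_trans yn)// hN.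
suff Vy : V (y - c *: x).
  exists (y - c *: x) => //; exists (c *: x); last by rewrite subrK.
  by exists c.
move/closed_approx: cV; apply => e e0.
have x0 : 0 < `|x|.
  by rewrite normr_gt0; apply: contra_notN nVx => /eqP->; exact: hV.1.
have [|N1 hN1] := @inv_natS_small (e / 2) hK; first by rewrite divr_gt0.
have [|N2 hN2] := hc (e / 2 / `|x|); first by rewrite !divr_gt0.
pose n := maxn N1 N2; have [Vn yn] := hcv n; exists (cv n).2 => //.
have -> : y - c *: x - (cv n).2 =
    (y - ((cv n).2 + (cv n).1 *: x)) + ((cv n).1 - c) *: x.
  by rewrite scalerBl opprD !addrA subrK addrAC.
rewrite (le_lt_trans (ler_normD _ _))// (splitr e) ltrD//.
  by rewrite (lt_trans yn)// hN1// leq_maxl.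
by rewrite normrZ -ltr_pdivlMr// hN2// leq_maxr.
Qed.

End Sequences.

(** * Compact perturbations of the identity *)

Section RieszSchauder.
Variable K : numFieldType.
Hypotheses (archiK : archimedean K) (completeK : seq_complete K^o).

(** Adding one vector at a time to {0} gives a chain of closed subspaces of
    the kernel, which is stationary. *)
Lemma one_minus_ker_dim (X : normedModType K) (k : X -> X) :
  linear k -> totally_bounded_op k ->
  exists d, quotient_dim [set x | x - k x = 0] [set 0] d.
Proof.
move=> link tbk; pose E := [set x | x - k x = 0].
have linT : linear (fun x => x - k x).
  by move=> a u v; rewrite link opprD addrACA scalerBr.
have hE : subspace_set E := subspace_ker linT.
have [N hN] := riesz_chain archiK link tbk.
pose good V := [/\ subspace_set V, closed V, V `<=` E &
  exists d, quotient_dim V [set 0] d].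
have step V : good V -> exists V',
    good V' /\ (V `<=` V' /\ (V' `<=` V -> E `<=` V)).
  move=> gV; have [hV cV VE [d Qd]] := gV.
  have [EV|/existsNP[x /not_implyP[Ex nVx]]] := pselect (E `<=` V).
    by exists V; split=> //; split.
  pose L := [set a *: x | a in setT].
  have hL : subspace_set L.
    split; first by exists 0; rewrite ?scale0r.
    move=> a _ _ [b _ <-] [c _ <-]; exists (a * b + c) => //.
    by rewrite scalerDl scalerA.
  have VL : V `<=` subspace_add V L.
    by move=> v Vv; exists v => //; exists 0; [exact: hL.1|rewrite addr0].
  exists (subspace_add V L); split; last first.
    split=> // /(_ x); suff xL : subspace_add V L x by move=> /(_ xL).
    exists 0; first exact: hV.1.
    by exists x; [exists 1; rewrite ?scale1r|rewrite add0r].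
  have hVL := subspace_addP hV hL; split=> //.
  - exact: closed_add_line.
  - move=> _ [v Vv [_ [a _ <-] <-]]; apply: subspaceD => //; first exact: VE.
    exact: subspaceZ.
  - exists (d + 1)%N.
    apply: (quotient_dim_cat hVL hV (@subspace0 _ _)) Qd _ => //.
      by move=> _ ->; exact: hV.1.
    apply/(quotient_dimP _ hVL hV); exists (fun=> x).
    have lc (c : 'rV[K]_1) : lincomb (fun=> x) c = c 0 0 *: x.
      by rewrite /lincomb big_ord1.
    split.
    + move=> _; exists 0; first exact: hV.1.
      by exists x; [exists 1; rewrite ?scale1r|rewrite add0r].
    + move=> _ [v Vv [_ [a _ <-] <-]]; exists a%:M.
      by rewrite lc mxE eqxx mulr1n addrK.
    + move=> c; rewrite lc => Vc; apply/rowP => i; rewrite ord1 mxE.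
      apply/eqP; apply: contra_notT nVx => c0.
      by rewrite -[x]scale1r -(mulVf c0) -scalerA; exact: subspaceZ.
pose next V :=
  if pselect (good V) is left g then projT1 (cid (step V g)) else V.
pose W j := iter j next [set 0].
have gW j : good (W j).
  elim: j => [|j IH] /=.
    split; [exact: subspace0| |by move=> _ ->; exact: hE.1|].
      apply/accessible_closed_set1/hausdorff_accessible.
      exact: norm_hausdorff.
    exists 0%N; apply/(quotient_dimP _ (@subspace0 _ _) (@subspace0 _ _)).
    exists (fun=> 0); split=> // [v ->|c _]; last by apply/rowP => -[].
    by exists 0; rewrite lincomb0 subr0.
  by rewrite /next; case: pselect => // g; case: cid => V' [].
have sW j : W j `<=` W j.+1 /\ (W j.+1 `<=` W j -> E `<=` W j).
  rewrite /W /= -/(W j) /next; case: pselect => [g|/(_ (gW j))//].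
  by case: cid => V' [].
have [j|j jN|j _ hj] := hN W.
- by case: (gW j).
- split; first by case: (sW j).
  move=> x Wx; have [h0 _ WE _] := gW j.+1.
  by rewrite (WE _ Wx); case: (gW j) => -[].
have [_ _ WE [d Qd]] := gW j; exists d.
suff -> : [set x | x - k x = 0] = W j by [].
by apply/seteqP; split => //; exact: (sW j).2.
Qed.

Lemma ultra_finite_cover T (U : set_system T) (I : eqType) (s : seq I)
    (A : I -> set T) : UltraFilter U ->
  (forall t, exists2 i, i \in s & A i t) -> exists2 i, i \in s & U (A i).
Proof.
move=> UU sA; apply: contrapT => nU.
have h (s' : seq I) : {subset s' <= s} ->
    U [set t | forall i, i \in s' -> ~ A i t].
  elim: s' => [_|i s' IH ss']; first by apply: filterS filterT => t _ i.
  have Ui : U (~` A i).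
    have [UA|//] := in_ultra_setVsetC (A i) UU.
    by exfalso; apply: nU; exists i => //; apply: ss'; rewrite mem_head.
  have /IH : {subset s' <= s} by move=> j js; apply: ss'; rewrite inE js orbT.
  apply: filterS2 Ui => t nA hs j; rewrite inE => /orP[/eqP->//|]; exact: hs.
have [t ht] := filter_ex (h s (fun _ => id)).
by have [i is_ At] := sA t; exact: (ht i is_).
Qed.

(** If [u n - k (u n)] converges, then along an ultrafilter [k (u n)] is
    Cauchy, hence so is [u n]. *)
Lemma bounded_preimage_cluster (X : completeNormedModType K) (k : X -> X)
    (u : nat -> X) (y : X) (C : K) :
  bounded_op k -> totally_bounded_op k ->
  (forall n, `|u n| <= C) -> seq_limit (fun n => u n - k (u n)) y ->
  exists2 x, x - k x = y & forall e : K, 0 < e -> exists n, `|u n - x| < e.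
Proof.
move=> bk tbk uC uy; have [M M0 kM] := bounded_op_opnorm bk.
have [[Lk Ek] _] := (linear_bundle bk.1, tt).
have C0 : 0 < C + 1.
  by rewrite ltr_wpDl// (le_trans (normr_ge0 _) (uC 0%N)).
have [U [UU Uoo]] := ultraFilterLemma (F := \oo) _.
have : cauchy ((k \o u) @ U).
  apply: cauchy_exP => e e0.
  have [|s hs] := tbk (e / (C + 1)); first by rewrite divr_gt0.
  have [|z _ hz] := @ultra_finite_cover _ U X s
      (fun z => [set n | `|(C + 1)^-1 *: k (u n) - z| < e / (C + 1)]) UU.
    move=> n; have [|z zs hz] := hs ((C + 1)^-1 *: u n).
      rewrite normrZ gtr0_norm ?invr_gt0// ler_pdivrMl// mulr1.
      by rewrite (le_trans (uC n))// lerDl.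
    by exists z => //=; rewrite Ek -linearZ -Ek.
  exists ((C + 1) *: z).
  suff : U [set n | ball ((C + 1) *: z) e (k (u n))] by [].
  apply: filterS hz => n /=.
  rewrite -ball_normE /= => h.
  have -> : (C + 1) *: z - k (u n) = - ((C + 1) *: ((C + 1)^-1 *: k (u n) - z)).
    by rewrite scalerBr scalerA divff ?gt_eqF// scale1r opprB.
  by rewrite normrN normrZ gtr0_norm// mulrC -ltr_pdivlMr.
move=> /cauchy_cvg/cvg_ex[z /cvg_ballP kz].
have near_x (e : K) : 0 < e -> exists n,
    `|u n - k (u n) - y| < e /\ `|u n - (y + z)| < e.
  move=> e0; have e2 : 0 < e / 2 by rewrite divr_gt0.
  have [N hN] := uy _ e2.
  have Uy : U [set n | `|u n - k (u n) - y| < e / 2].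
    by apply: Uoo; exists N.
  have Uz : U [set n | ball z (e / 2) (k (u n))] by exact: kz.
  have [n [/= h1 h2]] := filter_ex (filterI Uy Uz).
  exists n; split.
    by rewrite (lt_trans h1)// ltr_pdivrMr// mulr_natr mulr2n ltrDl.
  have -> : u n - (y + z) = (u n - k (u n) - y) - (z - k (u n)).
    by rewrite opprB [RHS]addrA [u n - _ - y + _]addrAC subrK opprD addrA.
  rewrite (le_lt_trans (ler_normB _ _))// (splitr e) ltrD//.
  by move: h2; rewrite -ball_normE.
exists (y + z); last by move=> e /near_x[n []]; exists n.
apply/eqP; rewrite -subr_eq0; apply/eqP.
apply: (@norm_small_eq0 _ _ _ (2 + M)); first by rewrite addr_gt0.
move=> e /near_x[n [h1 h2]]; set x := y + z.
have -> : x - k x - y = (u n - k (u n) - y) - ((u n - x) - k (u n - x)).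
  rewrite Ek (linearB Lk) -Ek.
  rewrite [- (k (u n) - k x)]opprD [u n - x + _]addrACA -[- x - _]opprD.
  by rewrite [- (_ - (x - k x))]opprB [RHS]addrC addrA subrK.
rewrite (le_trans (ler_normB _ _))//.
have : `|u n - x - k (u n - x)| <= e + M * e.
  rewrite (le_trans (ler_normB _ _))// lerD//; first exact: ltW.
  by rewrite (le_trans (kM _))// ler_pM2l// ltW.
move=> /(lerD (ltW h1)) /le_trans; apply.
by rewrite le_eqVlt; apply/orP; left; apply/eqP; ring.
Qed.

Section OneMinusCompact.
Variables (X : completeNormedModType K) (k : X -> X).
Hypotheses (bk : bounded_op k) (tbk : totally_bounded_op k).

Let T x := x - k x.

Lemma one_minus_linear : linear T.
Proof. by move=> a u v; rewrite /T bk.1 opprD addrACA scalerBr. Qed.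

Lemma one_minus_ker_closed : closed [set x | T x = 0].
Proof.
have [M M0 kM] := bounded_op_opnorm bk; have [Lk Ek] := linear_bundle bk.1.
apply/closed_approx => y hy; apply: (@norm_small_eq0 _ _ _ (1 + M)).
  by rewrite addr_gt0.
move=> e /hy[x Tx xy]; have -> : T y = (y - x) - k (y - x).
  rewrite Ek (linearB Lk) -Ek [- (k y - k x)]opprD [y - x + _]addrACA.
  by rewrite -[- x - _]opprD -/(T x) Tx subr0.
rewrite (le_trans (ler_normB _ _))// mulrDl mul1r lerD//; first exact: ltW.
by rewrite (le_trans (kM _))// ler_pM2l// ltW.
Qed.

(** Otherwise the Riesz lemma, applied to the kernel, gives vectors [w n] of
    the unit ball with [T (w n)] tending to 0 and at distance at least 1/2
    from the kernel, in contradiction with the existence of a cluster point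
    in the kernel. *)
Lemma one_minus_bounded_preimages : exists C : K, forall x, exists x',
  T x' = T x /\ `|x'| <= C * `|T x|.
Proof.
apply: contrapT => /forallNP nC.
have [L EL] := linear_bundle one_minus_linear.
have /choice[w hw] : forall n : nat, exists w, [/\ `|w| <= 1,
    forall v, T v = 0 -> 2^-1 <= `|w - v| & `|T w| < n.+1%:R^-1].
  move=> n; have /existsNP[x /forallNP hx] := nC n.+1%:R.
  have lt_x x' : T x' = T x -> n.+1%:R * `|T x| < `|x'|.
    move=> xx'; have /not_andP[//|/negP] := hx x'.
    by rewrite -real_ltNge ?realM ?realn ?normr_real.
  have nTx : T x <> 0.
    move=> Tx; have := lt_x 0; rewrite Tx EL linear0 normr0 mulr0 => /(_ erefl).
    by rewrite ltxx.
  have [s [v [s0 Tv h1 h2]]] := riesz_lemma archiK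
    (subspace_ker one_minus_linear) one_minus_ker_closed nTx.
  exists (s *: (x - v)); split=> //.
  have TE : T (x - v) = T x by rewrite EL linearB -EL Tv subr0.
  have -> : T (s *: (x - v)) = s *: T x by rewrite EL linearZ -EL TE.
  rewrite normrZ gtr0_norm// -[ltRHS]mulr1 ltr_pdivlMl ?ltr0n// mulrCA.
  have := lt_x _ TE; rewrite -(ltr_pM2l s0) => /lt_le_trans; apply.
  by move: h1; rewrite normrZ gtr0_norm.
have [|v Tv /(_ 2^-1)] := @bounded_preimage_cluster _ k w 0 1 bk tbk
    (fun n => let: And3 h _ _ := hw n in h).
  move=> e /(inv_natS_small archiK)[N hN]; exists N => n /hN.
  by rewrite subr0; apply: lt_trans; have [_ _] := hw n.
rewrite invr_gt0 ltr0n => /(_ isT)[n].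
by have [_ /(_ v Tv) /le_lt_trans h _] := hw n => /h; rewrite ltxx.
Qed.

Lemma one_minus_range_closed : closed (range T).
Proof.
have [C hC] := one_minus_bounded_preimages.
apply/closed_approx => y hy.
have /choice[u hu] : forall n : nat, exists u,
    `|u| <= `|C| * (`|y| + 1) /\ `|T u - y| < n.+1%:R^-1.
  move=> n; have [|_ [x _ <-] hx] := hy n.+1%:R^-1.
    by rewrite invr_gt0 ltr0n.
  have [x' [xx' x'C]] := hC x; exists x'; rewrite xx' distrC; split=> //.
  rewrite -[`|x'|]normr_id (le_trans (_ : _ <= `|C * `|T x| |))//.
    rewrite normr_id (le_trans x'C)// real_ler_norm// ger0_real//.
    by rewrite (le_trans _ x'C).
  rewrite normrM normr_id ler_wpM2l//.
  rewrite -[T x](subrK y) addrC (le_trans (ler_normD _ _))// lerD2l.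
  rewrite distrC (le_trans (ltW hx))// invf_le1 ?ltr0n//.
  by rewrite ler1n.
have [|x xE _] :=
  @bounded_preimage_cluster _ k u y _ bk tbk (fun n => (hu n).1).
  move=> e /(inv_natS_small archiK)[N hN]; exists N => n /hN.
  exact/lt_trans/(hu n).2.
by exists x.
Qed.

End OneMinusCompact.

(** Lets the results on the kernel and the range of [1 - k] be applied to its
    powers. *)
Lemma one_minus_iter (X : normedModType K) (k : X -> X) j :
  bounded_op k -> totally_bounded_op k ->
  exists kj : X -> X, [/\ bounded_op kj, totally_bounded_op kj
    & iter j (fun x => x - k x) = fun x => x - kj x].
Proof.
move=> bk tbk; elim: j => [|j [kj [bkj tbkj IH]]].
  exists (fun=> 0); split.
  - split; first by move=> a u v; rewrite scaler0 addr0.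
    by move=> x; exact: cvg_cst.
  - move=> e e0; exists [:: 0] => x _; exists 0; first by rewrite mem_head.
    by rewrite subrr normr0.
  - by apply/funext => x; rewrite subr0.
exists (kj + (k - (k \o kj))); split.
- split.
    have E x : (kj + (k - (k \o kj))) x = kj x + (k x - k (kj x)) by [].
    move=> a u v; rewrite !E bkj.1 !bk.1.
    by rewrite !scalerDr scalerN opprD [X in _ + X]addrACA [LHS]addrACA.
  move=> x; apply: cvgD; first exact: bkj.2.
  apply: cvgB; first exact: bk.2.
  by apply: continuous_comp; [exact: bkj.2|exact: bk.2].
- apply: totally_boundedD => //; apply: totally_boundedB => //.
  by apply: totally_bounded_compl => //; [exact: bk.1|exact: bounded_op_opnorm].
- apply/funext => x; rewrite iterS IH /= !fctE /=.
  have [Lk Ek] := linear_bundle bk.1.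
  by rewrite Ek (linearB Lk) -Ek [- (kj x + _)]opprD addrA.
Qed.

(** The kernels of the powers of [1 - k] form an increasing chain of closed
    subspaces, their ranges a decreasing one; [1 - k] maps each term of the
    first into the previous one, and each term of the second into the next,
    so that both are stationary by [riesz_chain]. *)
Theorem riesz_schauder (X : completeNormedModType K) (k : X -> X) :
  bounded_op k -> totally_bounded_op k ->
  exists n, quotient_dim [set x | x - k x = 0] [set 0] n /\
    quotient_dim setT (range (fun x => x - k x)) n.
Proof.
move=> bk tbk; set T := fun x => x - k x.
have linT : linear T by exact: one_minus_linear.
have [L EL] := linear_bundle linT.
have linTj j : linear (iter j T).
  by elim: j => [//|j IH] a u v; rewrite !iterS IH linT.
have T0 j : iter j T 0 = 0 by elim: j => //= j ->; rewrite EL linear0.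
have [N hN] := riesz_chain archiK bk.1 tbk.
have [j jN kerj] : exists2 j, (j < N)%N &
    [set x | iter j.+1 T x = 0] `<=` [set x | iter j T x = 0].
  apply: (hN (fun j => [set x | iter j T x = 0])) => j.
    split; first exact: subspace_ker.
    have [kj [bkj tbkj ->]] := one_minus_iter j bk tbk.
    exact: one_minus_ker_closed.
  move=> _; split=> x /= Tx; first by rewrite Tx EL linear0.
  by rewrite -/(T x) -iterSr.
have [i iN rani] : exists2 i, (i < N)%N &
    range (iter (N - i.+1) T) `<=` range (iter (N - i) T).
  (* numbered backwards, the ranges increase *)
  apply: (hN (fun j => range (iter (N - j) T))) => i.
    split; first exact: subspace_image.
    have [kj [bkj tbkj ->]] := one_minus_iter (N - i) bk tbk.
    exact: one_minus_range_closed.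
  move=> iN; rewrite -(subnSK iN); split=> [_ [x _ <-]|_ [x _ <-]].
    by exists (T x) => //; rewrite -iterSr.
  by exists x.
have [kN [bkN tbkN kNE]] := one_minus_iter N bk tbk.
have [d Qd] := one_minus_ker_dim bkN.1 tbkN.
apply: (@stationary_index0 _ _ _ N d) => //.
- exact: leq_ltn_trans jN.
- move=> x; rewrite -(subnKC (ltnW jN)) -addSn !iterD; exact: kerj.
- move=> x; have [|y _ xy] := rani (iter (N - i.+1) T x); first by exists x.
  exists y; rewrite -{1}(subnKC iN) iterD -xy -iterD.
  by rewrite addSn subnKC// ltnW.
- by rewrite kNE.
Qed.

End RieszSchauder.

(** * Neumann series and close projectors *)

Section Neumann.
Variables (K : numFieldType) (X : normedModType K).
Hypotheses (archiK : archimedean K) (completeX : seq_complete X).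

Lemma contraction_fixed0 (D : X -> X) x :
  opnorm_le D 2^-1 -> x - D x = 0 -> x = 0.
Proof.
move=> hD /eqP; rewrite subr_eq0 => /eqP xD.
apply/eqP; rewrite -normr_eq0; apply: contraT => x0.
have xgt0 : 0 < `|x| by rewrite lt_def x0 normr_ge0.
have := hD x; rewrite -xD ler_pdivlMl// mulr_natl mulr2n gerDl.
by move=> /(lt_le_trans xgt0); rewrite ltxx.
Qed.

Lemma opnorm_le_iter (D : X -> X) n :
  opnorm_le D 2^-1 -> opnorm_le (iter n D) (2^-1 ^+ n).
Proof.
move=> hD; elim: n => [|n IH] x; first by rewrite expr0 mul1r.
rewrite iterS exprS -mulrA (le_trans (hD _))// ler_pM2l ?invr_gt0//.
Qed.

Lemma exp_half_small (e : K) : 0 < e -> exists n, 2^-1 ^+ n < e.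
Proof.
move=> /(inv_natS_small archiK)[N hN]; exists N.
apply: le_lt_trans (hN N (leqnn N)).
by rewrite exprVn lef_pV2 ?posrE ?exprn_gt0 ?ltr0n// -natrX ler_nat ltn_expl.
Qed.

(** The Neumann series of [1 - D]. *)
Lemma contraction_solve (D : X -> X) y : linear D ->
  opnorm_le D 2^-1 -> exists x, x - D x = y.
Proof.
move=> linD hD; have [L EL] := linear_bundle linD.
pose u n := iter n (fun x => y + D x) 0.
have uE m n : u (n + m)%N - u n = iter n D (u m).
  elim: n => [|n IH]; first by rewrite subr0.
  rewrite addSn /u !iterS opprD addrACA subrr add0r -/(u _) -/(u n).
  by rewrite -IH EL linearB.
have u_bd n : `|u n| <= 2 * `|y|.
  elim: n => [|n IH]; first by rewrite normr0 mulr_ge0.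
  rewrite /u iterS -/(u n) (le_trans (ler_normD _ _))// mulr_natl mulr2n.
  by rewrite lerD2l (le_trans (hD _))// ler_pdivrMl.
have y1 : 0 < 2 * `|y| + 1 by rewrite ltr_wpDl// mulr_ge0.
have [|l ul] := completeX (u := u).
  move=> e e0; have [|N hN] := @exp_half_small (e / (2 * `|y| + 1)).
    by rewrite divr_gt0.
  exists N => n Nn; rewrite -(subnKC Nn) uE.
  rewrite (le_lt_trans (opnorm_le_iter _ hD _))//.
  move: hN; rewrite ltr_pdivlMr//; apply: le_lt_trans.
  rewrite ler_pM2l ?exprn_gt0 ?invr_gt0//.
  by rewrite (le_trans (u_bd _))// lerDl.
exists l; apply/eqP; rewrite -subr_eq0; apply/eqP.
apply: (@norm_small_eq0 _ _ _ 2) => // e e0; have [N hN] := ul e e0.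
have -> : l - D l - y = D (u N - l) - (u N.+1 - l).
  rewrite EL linearB -EL /u iterS -/(u N) opprB.
  by rewrite [RHS]addrC opprD [l + (_ - _)]addrA [RHS]addrA subrK addrAC.
rewrite (le_trans (ler_normB _ _))// mulr_natl mulr2n lerD//; last first.
  by rewrite ltW// hN.
rewrite (le_trans (hD _))// ler_pdivrMl//.
by rewrite (le_trans (ltW (hN _ (leqnn N))))// ler_peMl ?ltW// ltr1n.
Qed.

End Neumann.

Definition bijective_op (K : numFieldType) (X : normedModType K) (U : X -> X) :=
  (forall y, exists x, U x = y) /\ forall x, U x = 0 -> x = 0.

Section CloseProjectors.
Variables (K : numFieldType) (X : normedModType K).
Hypotheses (archiK : archimedean K) (completeX : seq_complete X).

(** For projectors [P] and [Q], this is QP + (1 - Q)(1 - P); it maps the range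
    of [P] into that of [Q], and its product with the operator obtained by
    exchanging [P] and [Q] is 1 - (P - Q)^2. *)
Definition intertwiner (P Q : X -> X) (x : X) :=
  Q (P x) + (x - P x) - Q (x - P x).

Section Intertwiner.
Variables P Q : X -> X.
Hypotheses (linP : linear P) (linQ : linear Q).
Hypotheses (PP : P \o P = P) (QQ : Q \o Q = Q).

Let PPx y : P (P y) = P y. Proof. exact: (congr1 (@^~ y) PP). Qed.

Let QQx y : Q (Q y) = Q y. Proof. exact: (congr1 (@^~ y) QQ). Qed.

Lemma intertwiner_linear : linear (intertwiner P Q).
Proof.
move=> a u v; rewrite /intertwiner.
have -> : a *: u + v - P (a *: u + v) = a *: (u - P u) + (v - P v).
  by rewrite linP opprD addrACA scalerBr.
rewrite linP !linQ opprD [X in X + _ = _]addrACA [LHS]addrACA.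
by rewrite [a *: (_ + _ - _)]scalerDr scalerN [a *: (_ + (_ - _))]scalerDr.
Qed.

Lemma intertwiner_on_range x : intertwiner P Q (P x) = Q (P x).
Proof.
have [LQ EQ] := linear_bundle linQ.
by rewrite /intertwiner PPx subrr EQ linear0 subr0 addr0.
Qed.

Lemma intertwiner_range x : Q (intertwiner P Q x) = Q (P x).
Proof.
have [LQ EQ] := linear_bundle linQ.
by rewrite /intertwiner EQ linearB linearD -EQ !QQx addrK.
Qed.

End Intertwiner.

Lemma intertwiner_mul (P Q : X -> X) x : linear P -> linear Q ->
  P \o P = P -> Q \o Q = Q ->
  intertwiner P Q (intertwiner Q P x) = x - (P (P x - Q x) - Q (P x - Q x)).
Proof.
move=> linP linQ PP QQ.
have [LP EP] := linear_bundle linP; have [LQ EQ] := linear_bundle linQ.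
have PPx y : P (P y) = P y by exact: (congr1 (@^~ y) PP).
have QQx y : Q (Q y) = Q y by exact: (congr1 (@^~ y) QQ).
have PB u v : P (u - v) = P u - P v by rewrite EP linearB.
have QB u v : Q (u - v) = Q u - Q v by rewrite EQ linearB.
rewrite {1}/intertwiner (intertwiner_range Q linP PP).
have -> : intertwiner Q P x - P (Q x) = (x - Q x) - P (x - Q x).
  by rewrite /intertwiner addrAC [P (Q x) + _]addrC addrK.
rewrite !(PB, QB) !QQx !PPx subrr sub0r opprK.
rewrite [Q (P (Q x)) + _]addrC -addrA [Q (P (Q x)) + _]addrC subrK.
rewrite [- (P x - P (Q x) - _)]opprB [RHS]addrA [x + (_ - _)]addrA.
by rewrite [LHS]addrAC [x - Q x + _]addrAC.
Qed.

Lemma intertwiner_bijective (P Q : X -> X) : linear P -> linear Q ->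
  P \o P = P -> Q \o Q = Q ->
  opnorm_le (Q - P) 2^-1 -> bijective_op (intertwiner P Q).
Proof.
move=> linP linQ PP QQ QP.
have [LP EP] := linear_bundle linP; have [LQ EQ] := linear_bundle linQ.
have linD (P' Q' : X -> X) : linear P' -> linear Q' ->
    linear (fun x => P' (P' x - Q' x) - Q' (P' x - Q' x)).
  move=> linP' linQ' a u v.
  have -> : P' (a *: u + v) - Q' (a *: u + v) =
      a *: (P' u - Q' u) + (P' v - Q' v).
    by rewrite linP' linQ' opprD addrACA scalerBr.
  by rewrite linP' linQ' opprD addrACA scalerBr.
have hD (P' Q' : X -> X) : (forall x, `|P' x - Q' x| <= 2^-1 * `|x|) ->
    opnorm_le (fun x => P' (P' x - Q' x) - Q' (P' x - Q' x)) 2^-1.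
  move=> h x; rewrite (le_trans (h _))// ler_pM2l ?invr_gt0//.
  by rewrite (le_trans (h _))// ler_piMl// invf_le1// ler1n.
have D1 := hD _ _ QP.
have D2 : opnorm_le (fun x => P (P x - Q x) - Q (P x - Q x)) 2^-1.
  by apply: hD => x; rewrite distrC; exact: QP.
split=> [y|x Wx].
  have [x hx] := contraction_solve archiK completeX y (linD _ _ linP linQ) D2.
  by exists (intertwiner Q P x); rewrite intertwiner_mul.
apply: (contraction_fixed0 D1).
apply: etrans (esym (intertwiner_mul x linQ linP QQ PP)) _; rewrite Wx.
by rewrite /intertwiner EP EQ !linear0 !addr0 !linear0 addr0.
Qed.

End CloseProjectors.

(** * Compressions to the first summand *)

Section IdempotentModuloCompact.
Variables (K : numFieldType) (X : normedModType K).
Hypothesis archiK : archimedean K.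

(** If [f] is idempotent modulo compact operators and is the sum of a
    contraction [g] and of a compact operator, then [f] agrees with every
    power of [g] modulo compact operators, hence is a limit of compact
    operators. In other words, 0 is isolated among the idempotents of the
    Calkin algebra. *)
Lemma idempotent_mod_compact (f g : X -> X) :
  bounded_op f -> bounded_op g -> opnorm_le g 2^-1 ->
  totally_bounded_op (f \o f - f) -> totally_bounded_op (f - g) ->
  totally_bounded_op f.
Proof.
move=> bf bg hg ff fg.
have lin_iter n : linear (iter n.+1 g).
  by elim: n => [|n IH] a u v; rewrite iterS ?bg.1// IH bg.1.
have pow n : totally_bounded_op (f - iter n.+1 g).
  elim: n => [//|n IH].
  have -> : f - iter n.+2 g =
      (f \o (f - iter n.+1 g)) + ((f - g) \o iter n.+1 g) - (f \o f - f).
    apply/funext => x; have [Lf Ef] := linear_bundle bf.1.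
    rewrite -[RHS]/(f (f x - iter n.+1 g x) +
      (f (iter n.+1 g x) - g (iter n.+1 g x)) - (f (f x) - f x)).
    rewrite {2}Ef (linearB Lf) -Ef [f (f x) - _ + _]addrA subrK.
    by rewrite [- (_ - f x)]opprB [RHS]addrC addrA subrK.
  apply: totally_boundedB => //; apply: totally_boundedD.
    apply: totally_bounded_compl => //; first exact: bf.1.
    exact: bounded_op_opnorm.
  apply: totally_bounded_compr => //.
    move=> a u v; rewrite -![(f - g) _]/(f _ - g _) bf.1 bg.1.
    by rewrite opprD addrACA scalerBr.
  exists (2^-1 ^+ n.+1); first by rewrite exprn_gt0// invr_gt0.
  exact: opnorm_le_iter.
apply: totally_bounded_approx => e e0; have [n hn] := exp_half_small archiK e0.
exists (f - iter n.+1 g) => // x.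
have -> : (f - (f - iter n.+1 g)) x = iter n.+1 g x.
  by rewrite -[LHS]/(f x - (f x - iter n.+1 g x)) subKr.
rewrite (le_trans (opnorm_le_iter _ hg _))// ler_wpM2r//.
rewrite (le_trans _ (ltW hn))// exprS ler_piMl ?exprn_ge0 ?invr_ge0//.
by rewrite invf_le1// ler1n.
Qed.

End IdempotentModuloCompact.

Section Corner.
Variables (K : numFieldType) (F G : normedModType K).
Local Notation X := (F * G)%type.
Implicit Types S T Q U : X -> X.

(** The compression of an operator on F * G to F. *)
Definition corner T (x : F) : F := (T (x, 0)).1.

Lemma opnorm_inl : exists2 M : K, 0 < M & opnorm_le (fun x : F => (x, 0) : X) M.
Proof.
exists 1 => // x; rewrite mul1r; apply: norm_pair_le => //=.
by rewrite normr0.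
Qed.

Lemma opnorm_inr : exists2 M : K, 0 < M & opnorm_le (fun y : G => (0, y) : X) M.
Proof.
exists 1 => // x; rewrite mul1r; apply: norm_pair_le => //=.
by rewrite normr0.
Qed.

Lemma linear_inl : linear (fun x : F => (x, 0) : X).
Proof.
by move=> a u v; rewrite -[RHS]/(a *: u + v, a *: (0 : G) + 0) scaler0 addr0.
Qed.

Lemma linear_inr : linear (fun y : G => (0, y) : X).
Proof.
by move=> a u v; rewrite -[RHS]/(a *: (0 : F) + 0, a *: u + v) scaler0 addr0.
Qed.

Lemma opnorm_bounded_op (Y Z : normedModType K) (T : Y -> Z) : linear T ->
  (exists2 M : K, 0 < M & opnorm_le T M) -> bounded_op T.
Proof.
move=> linT [M M0 hM]; split=> // x; have [L EL] := linear_bundle linT.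
apply/cvg_ballP => e e0; apply/nbhs_ballP; exists (e / M) => /=.
  by rewrite divr_gt0.
move=> y; rewrite -!ball_normE /= EL -linearB -EL => xy.
by rewrite (le_lt_trans (hM _))// mulrC -ltr_pdivlMr.
Qed.

Lemma bounded_op_comp (Y Z W : normedModType K) (S : Z -> W) (T : Y -> Z) :
  bounded_op S -> bounded_op T -> bounded_op (S \o T).
Proof.
move=> [linS cS] [linT cT]; split; first by move=> a u v; rewrite /= linT linS.
by move=> x; apply: continuous_comp; [exact: cT|exact: cS].
Qed.

Lemma bounded_inl : bounded_op (fun x : F => (x, 0) : X).
Proof. exact: (opnorm_bounded_op linear_inl opnorm_inl). Qed.

Lemma bounded_inr : bounded_op (fun y : G => (0, y) : X).
Proof. exact: (opnorm_bounded_op linear_inr opnorm_inr). Qed.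

Lemma bounded_fst : bounded_op (fst : X -> F).
Proof.
apply: opnorm_bounded_op => //; exists 1 => // x; rewrite mul1r.
exact: norm_fst_le.
Qed.

Lemma bounded_snd : bounded_op (snd : X -> G).
Proof.
apply: opnorm_bounded_op => //; exists 1 => // x; rewrite mul1r.
exact: norm_snd_le.
Qed.

Lemma bounded_corner T : bounded_op T -> bounded_op (corner T).
Proof.
move=> bT; apply: (@bounded_op_comp _ _ _ fst (T \o _)).
  exact: bounded_fst.
by apply: bounded_op_comp => //; exact: bounded_inl.
Qed.

Hypothesis hGF : forall T : G -> F, bounded_op T -> compact_op T.

(** Operators from G to F being compact, the compression to F is
    multiplicative modulo compact operators. *)
Lemma corner_comp S T : bounded_op S -> bounded_op T ->
  totally_bounded_op (corner (S \o T) - (corner S \o corner T)).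
Proof.
move=> bS bT; have [LS ES] := linear_bundle bS.1.
pose B y := (S (0, y)).1; pose C x := (T (x, 0)).2.
have -> : corner (S \o T) - (corner S \o corner T) = B \o C.
  apply/funext => x.
  rewrite -[LHS]/((S (T (x, 0))).1 - (S ((T (x, 0)).1, 0)).1).
  rewrite ES -[_ - _]/((LS (T (x, 0)) - LS ((T (x, 0)).1, 0)).1) -linearB -ES.
  rewrite /B /C /=; case: (T (x, 0)) => p q /=.
  by rewrite -[(p, q) - (p, 0)]/(p - p, q - 0) subrr subr0.
have bB : bounded_op B.
  apply: (@bounded_op_comp _ _ _ fst (S \o _)); first exact: bounded_fst.
  by apply: bounded_op_comp => //; exact: bounded_inr.
have bC : bounded_op C.
  apply: (@bounded_op_comp _ _ _ snd (T \o _)); first exact: bounded_snd.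
  by apply: bounded_op_comp => //; exact: bounded_inl.
apply: totally_bounded_compr; [exact: bB.1|exact: bounded_op_opnorm|].
exact/compact_totally_bounded/hGF.
Qed.

Lemma corner_comp_one S T : bounded_op S -> bounded_op T ->
  totally_bounded_op (corner S - id) -> totally_bounded_op (corner T - id) ->
  totally_bounded_op (corner (S \o T) - id).
Proof.
move=> bS bT hS hT.
have -> : corner (S \o T) - id = (corner (S \o T) - (corner S \o corner T)) +
    (((corner S - id) \o corner T) + (corner T - id)).
  apply/funext => x.
  rewrite -[RHS]/((corner (S \o T) x - corner S (corner T x)) +
    ((corner S (corner T x) - corner T x) + (corner T x - x))).
  by rewrite [X in _ = _ + X]addrA subrK [RHS]addrA subrK.
apply: totally_boundedD; first exact: corner_comp.
apply: totally_boundedD => //; apply: totally_bounded_compr => //.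
  move=> a u v; rewrite -![(corner S - id) _]/(corner S _ - _).
  by rewrite (bounded_corner bS).1 opprD addrACA scalerBr.
exact: bounded_op_opnorm (bounded_corner bT).
Qed.

(** [1 - corner Q'] is idempotent modulo compact operators, and differs from
    the contraction [corner Q - corner Q'] by a compact operator. *)
Lemma corner_close_projector Q Q' : archimedean K ->
  projector Q -> projector Q' ->
  opnorm_le (Q' - Q) 2^-1 ->
  totally_bounded_op (corner Q - id) -> totally_bounded_op (corner Q' - id).
Proof.
move=> archiK [bQ QQ] [bQ' QQ'] h cQ.
have bc := bounded_corner bQ; have bc' := bounded_corner bQ'.
have linB (A B : F -> F) : linear A -> linear B -> linear (A - B).
  move=> lA lB a u v; rewrite -![(A - B) _]/(A _ - B _) lA lB.
  by rewrite opprD addrACA scalerBr.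
have cB (A B : F -> F) : bounded_op A -> bounded_op B -> bounded_op (A - B).
  move=> [lA cA] [lB cB']; split; first exact: linB.
  by move=> x; apply: cvgB; [exact: cA|exact: cB'].
have bid : bounded_op (id : F -> F).
  by split=> // x; exact: cvg_id.
pose f : F -> F := id - corner Q'.
have hf : totally_bounded_op f.
  apply: (@idempotent_mod_compact _ _ archiK f (corner Q - corner Q')).
  - exact: cB.
  - exact: cB.
  - move=> x; have := le_trans (norm_fst_le _) (h (x, 0)).
    rewrite distrC => /le_trans; apply; rewrite ler_pM2l ?invr_gt0//.
    by apply: norm_pair_le => //=; rewrite normr0.
  - have -> : f \o f - f = - (corner (Q' \o Q') - (corner Q' \o corner Q')).
      apply/funext => x; rewrite QQ'; have [L EL] := linear_bundle bc'.1.
      rewrite -[LHS]/((x - corner Q' x) - corner Q' (x - corner Q' x) -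
         (x - corner Q' x)).
      rewrite -[RHS]/(- (corner Q' x - corner Q' (corner Q' x))).
      by rewrite addrAC subrr sub0r EL (linearB L).
    by apply: totally_boundedN; exact: corner_comp.
  - have -> : f - (corner Q - corner Q') = - (corner Q - id).
      apply/funext => x.
      rewrite -[LHS]/(x - corner Q' x - (corner Q x - corner Q' x)).
      rewrite -[RHS]/(- (corner Q x - x)).
      by rewrite !opprB [LHS]addrA subrK.
    exact: totally_boundedN.
have -> : corner Q' - id = - f.
  by apply/funext => x; rewrite -[RHS]/(- (x - corner Q' x)) opprB.
exact: totally_boundedN.
Qed.

End Corner.

(** * Constancy of the index along a path of projectors *)

Section Transport.
Variables (K : numFieldType) (F G : normedModType K).
Local Notation X := (F * G)%type.
Hypotheses (archiK : archimedean K) (completeX : seq_complete X).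
Hypothesis hGF : forall T : G -> F, bounded_op T -> compact_op T.

(** The invariant carried along a path of projectors starting at [Q0]: an
    automorphism [U] of the whole space maps the range of [Q0] onto that of
    [Q], and the operator [F -> range Q0 -> range Q -> F] made of [Q0], [U]
    and the projection is the identity modulo compact operators. *)
Definition transported (Q0 Q : X -> X) :=
  totally_bounded_op (corner Q - id) /\
  exists U : X -> X, [/\ bounded_op U, bijective_op U, U \o Q0 = Q \o U
    & totally_bounded_op (corner (U \o Q0) - id)].

Lemma intertwiner_bounded (Y : normedModType K) (P Q : Y -> Y) :
  bounded_op P -> bounded_op Q -> bounded_op (intertwiner P Q).
Proof.
move=> [linP cP] [linQ cQ]; split; first exact: intertwiner_linear.
have cI : continuous (fun x => x - P x).
  by move=> x; apply: cvgB; [exact: cvg_id|exact: cP].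
move=> x; apply: cvgB.
  apply: cvgD; last exact: cI.
  by apply: (continuous_comp (f := P)); [exact: cP|exact: cQ].
by apply: (continuous_comp (f := fun x => x - P x)); [exact: cI|exact: cQ].
Qed.

(** For the intertwiner [W] of [Q] and [Q'], the operator W U Q0 is Q' (U Q0),
    a product of operators whose compressions are 1 modulo compact
    operators. *)
Lemma transported_step (Q0 Q Q' : X -> X) : projector Q0 -> projector Q ->
  projector Q' -> opnorm_le (Q' - Q) 2^-1 ->
  transported Q0 Q -> transported Q0 Q'.
Proof.
move=> [bQ0 _] pQ pQ' h [cQ [U [bU [Usurj Uinj] UQ cU]]].
have [bQ QQ] := pQ; have [bQ' QQ'] := pQ'.
have cQ' := corner_close_projector hGF archiK pQ pQ' h cQ; split=> //.
have [Wsurj Winj] := intertwiner_bijective archiK completeX bQ.1 bQ'.1 QQ QQ' h.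
have UQx x : U (Q0 x) = Q (U x) by exact: (congr1 (@^~ x) UQ).
have WUQ : (intertwiner Q Q' \o U) \o Q0 = Q' \o (U \o Q0).
  by apply/funext => x; rewrite /= UQx intertwiner_on_range// ; exact: bQ'.1.
exists (intertwiner Q Q' \o U); split.
- by apply: bounded_op_comp => //; exact: intertwiner_bounded.
- split=> [y|x /Winj /Uinj//].
  by have [x <-] := Wsurj y; have [z <-] := Usurj x; exists z.
- rewrite WUQ; apply/funext => x; rewrite /= UQx.
  by rewrite (intertwiner_range _ bQ'.1 QQ').
- rewrite WUQ; apply: corner_comp_one => //.
  exact: bounded_op_comp.
Qed.

End Transport.

(** The unit interval being connected, a locally constant property holds at 1
    if it holds at 0. *)
Lemma unit_interval_induction (R : realType) (P : R -> Prop) :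
  (forall t : R, 0 <= t <= 1 ->
    \forall s \near within `[0, 1]%classic (nbhs t), P t <-> P s) ->
  P 0 -> P 1.
Proof.
move=> locP P0; pose I : set R := `[0, 1]%classic.
have inI t : I t <-> 0 <= t <= 1 by rewrite /I /= in_itv.
pose B : set R := I `&` [set t | P t].
suff BI : B = I.
  have : I 1 by apply/inI; rewrite ler01 lexx.
  by rewrite -BI => -[].
have cI : connected I by exact: segment_connected.
apply: cI.
- by exists 0; split=> //; apply/inI; rewrite ler01 lexx.
- exists (interior [set s | I s -> P s]); first exact: open_interior.
  apply/seteqP; split=> t [It] => [Pt|/nbhs_singleton/(_ It)//]; split=> //.
  by apply: filterS (locP t (proj1 (inI t) It)) => s [h _]; exact: h.
- exists (~` interior [set s | I s -> ~ P s]).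
    by rewrite closedC; exact: open_interior.
  apply/seteqP; split=> t [It] => [Pt|nt]; split=> //.
    by move=> /nbhs_singleton /(_ It); apply.
  apply: contrapT => nPt; apply: nt.
  by apply: filterS (locP t (proj1 (inI t) It)) => s [_ h] /h.
Qed.

Lemma left_projector_linear (K : numFieldType) (F G : normedModType K) :
  linear (@left_projector K F G).
Proof.
move=> a u v; rewrite -[RHS]/(a *: u.1 + v.1, a *: (0 : G) + 0).
by rewrite scaler0 addr0.
Qed.

Section IndexOfProjectors.
Variables (K : numFieldType) (F G : completeNormedModType K).
Local Notation X := ((F * G)%type : normedModType K).
Local Notation P := (@left_projector _ F G).
Hypotheses (archiK : archimedean K) (completeK : seq_complete K^o).
Hypothesis hGF : forall T : G -> F, bounded_op T -> compact_op T.

(** Replaces the target F * 0 of the relative dimension by F itself, on which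
    the compressions act. *)
Lemma relative_dim_fst (Q : X -> X) (k : int) :
  linear Q -> relative_dim Q P k ->
  exists n m, [/\ quotient_dim (range Q `&` [set y : X | y.1 = 0]) [set 0] n,
    quotient_dim setT ((fst : X -> F) @` range Q) m & k = n%:Z - m%:Z].
Proof.
move=> linQ [n [m [Qn Qm ->]]]; exists n, m; split=> //.
  rewrite (_ : [set y : X | y.1 = 0] = [set v | P v = 0])//.
  apply/seteqP; split=> -[x y]; rewrite /left_projector /=; first by move=> ->.
  by case.
have hQ := subspace_image linQ (@subspaceT K X).
have linP : linear P by exact: left_projector_linear.
apply: (quotient_dim_preimage (T := fun x : F => (x, 0) : X)) Qm => //.
- exact: (subspace_image (bounded_fst F G).1 hQ).
- exact: (subspace_image linP (@subspaceT K X)).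
- exact: (subspace_image linP hQ).
- exact: linear_inl.
- by move=> x _; exists (x, 0).
- move=> _ [x _ <-]; exists x.1 => //.
  by rewrite subrr; exact: (subspace_image linP hQ).1.
- move=> x _; split=> [[y Qy <-]|[y Qy [yx]]]; first by exists y.
  by exists y.
Qed.

(** With [S : F -> range Q0] the restriction of [Q0], both the projection of
    [range Q0] to F and, through [U], that of [range Q] are left inverse to
    [S] modulo compact operators, so their indices are the opposite of the
    index of [S]. *)
Lemma transported_relative_dim (Q0 Q : X -> X) (k0 k1 : int) :
  projector Q0 -> projector Q -> totally_bounded_op (corner Q0 - id) ->
  transported Q0 Q -> relative_dim Q0 P k0 -> relative_dim Q P k1 -> k0 = k1.
Proof.
move=> [bQ0 QQ0] [bQ QQ] c0 [_ [U [bU [Usurj Uinj] UQ cU]]].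
move=> /(relative_dim_fst bQ0.1)[n0 [m0 [Qn0 Qm0 ->]]].
move=> /(relative_dim_fst bQ.1)[n1 [m1 [Qn1 Qm1 ->]]].
pose S x : X := Q0 (x, 0).
have linS : linear S.
  by move=> a u v; rewrite /S -bQ0.1; congr Q0; exact: linear_inl.
have hV0 := subspace_image bQ0.1 (@subspaceT K X).
have hV := subspace_image bQ.1 (@subspaceT K X).
have SV x : range Q0 (S x) by exists (x, 0).
have index0 (T : X -> X) : bounded_op T -> totally_bounded_op (corner T - id) ->
    exists p, quotient_dim [set x | corner T x = 0] [set 0] p /\
      quotient_dim setT (range (corner T)) p.
  move=> bT cT.
  have E : (fun x => x - (id - corner T) x) = corner T.
    by apply/funext => x; rewrite -[LHS]/(x - (x - corner T x)) subKr.
  have tk : totally_bounded_op (id - corner T).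
    have -> : id - corner T = - (corner T - id).
      by apply/funext => x; rewrite -[RHS]/(- (corner T x - x)) opprB.
    exact: totally_boundedN.
  have bk : bounded_op (id - corner T).
    have [lc cc] := bounded_corner bT; split.
      move=> a u v; rewrite -![(id - corner T) _]/(_ - corner T _) lc.
      by rewrite opprD addrACA scalerBr.
    by move=> x; apply: cvgB; [exact: cvg_id|exact: cc].
  have [p] := riesz_schauder archiK completeK bk tk.
  rewrite (_ : [set x | x - (id - corner T) x = 0] = [set x | corner T x = 0]).
    by rewrite E => -[]; exists p.
  by rewrite -{2}E.
have linU := bU.1; have [LU EU] := linear_bundle linU.
have linfU : linear (fst \o U : X -> F) by move=> a u v; rewrite /= linU.
have UQx x : U (Q0 x) = Q (U x) by exact: (congr1 (@^~ x) UQ).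
have {}Qn1 :
    quotient_dim (range Q0 `&` [set y : X | (fst \o U) y = 0]) [set 0] n1.
  apply: (quotient_dim_preimage _ (@subspace0 _ _) _ (@subspace0 _ _) linU) Qn1.
  - by apply: subspaceI => //; exact: subspace_ker.
  - by apply: subspaceI => //; exact: (subspace_ker (bounded_fst F G).1).
  - by move=> _ [[x _ <-] /= fU]; split=> //; rewrite UQx; exists (U x).
  - move=> y [[x _ <-] Qx]; have [z zx] := Usurj x.
    exists (Q0 z); last by rewrite UQx zx subrr.
    by split; [exists z|rewrite /= UQx zx].
  - by move=> y _; split=> [->|/Uinj//]; rewrite EU linear0.
have {}Qm1 : quotient_dim setT ((fst \o U : X -> F) @` range Q0) m1.
  rewrite (_ : _ @` _ = (fst : X -> F) @` range Q)//.
  apply/seteqP; split=> [_ [_ [x _ <-] <-]|_ [_ [x _ <-] <-]].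
    by exists (Q (U x)); [exists (U x)|rewrite /= UQx].
  have [z <-] := Usurj x.
  by exists (Q0 z); [exists z|rewrite /= UQx].
have [p [Qp Qp']] := index0 _ bQ0 c0.
have [q [Qq Qq']] := index0 _ (bounded_op_comp bU bQ0) cU.
have [kS [cS [QkS QcS E0]]] :=
  index_comp linS (bounded_fst F G).1 hV0 SV Qn0 Qm0 Qp Qp'.
have [kS' [cS' [QkS' QcS' E1]]] :=
  index_comp linS linfU hV0 SV Qn1 Qm1 Qq Qq'.
have kE := quotient_dim_uniq (subspace_ker linS) (@subspace0 _ _) QkS QkS'.
have hrS := subspace_image linS (@subspaceT _ _).
have cE := quotient_dim_uniq hV0 hrS QcS QcS'.
by lia.
Qed.

Lemma relative_dim_constant (R : realType) (Q : R -> X -> X) (k0 k1 : int) :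
  norm_continuous_on (`[0, 1]%classic : set R) Q ->
  (forall t, 0 <= t <= 1 -> projector (Q t)) ->
  totally_bounded_op (corner (Q 0) - id) ->
  relative_dim (Q 0) P k0 -> relative_dim (Q 1) P k1 -> k0 = k1.
Proof.
move=> cQ pQ c0; have p0 : projector (Q 0) by apply: pQ; rewrite lexx ler01.
have p1 : projector (Q 1) by apply: pQ; rewrite lexx ler01.
apply: transported_relative_dim => //.
have completeX : seq_complete X.
  by apply: seq_complete_prod; exact: completeNormed_seq_complete.
pose T (t : R) := 0 <= t <= 1 -> transported (Q 0) (Q t).
suff : T 1 by apply; rewrite lexx ler01.
apply: (@unit_interval_induction R T) => [t t01|_]; last first.
  split=> //; exists id; split=> //.
  - by split=> // x; exact: cvg_id.
  - by split=> [y|//]; exists y.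
have half : 0 < 2^-1 :> K by rewrite invr_gt0.
have t01' : (`[0, 1]%classic : set R) t by rewrite /= in_itv.
have near_t : nbhs t [set s | (`[0, 1]%classic : set R) s ->
  opnorm_le (Q s - Q t) 2^-1] := cQ t t01' _ half.
suff : nbhs t [set s | (`[0, 1]%classic : set R) s -> (T t <-> T s)] by [].
apply: filterS near_t => s hs s01.
have {}hs := hs s01; have {}s01 : 0 <= s <= 1 by move: s01; rewrite /= in_itv.
have hs' : opnorm_le (Q t - Q s) 2^-1.
  by move=> x; have := hs x; rewrite -[(Q t - Q s) x]/(Q t x - Q s x) distrC.
split=> h _.
  by apply: transported_step (pQ _ t01) (pQ _ s01) hs (h t01).
by apply: transported_step (pQ _ s01) (pQ _ t01) hs' (h s01).
Qed.

End IndexOfProjectors.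

(** * The fields of scalars *)

Section ScalarField.
Variables (R : realType) (k : scalar_kind).
Local Open Scope complex_scope.

Lemma complex_ge0 (a : R[i]) :
  0 <= a -> a = (complex.Re a)%:C /\ 0 <= complex.Re a.
Proof. by case: a => x y; rewrite lecE /= => /andP[/eqP-> ->]. Qed.

Lemma complex_gt0 (a : R[i]) :
  0 < a -> a = (complex.Re a)%:C /\ 0 < complex.Re a.
Proof. by case: a => x y; rewrite ltcE /= => /andP[/eqP-> ->]. Qed.

Lemma scalar_archimedean : archimedean (scalar_field R k).
Proof.
case: k => a /=; first by move=> a0; exists (Num.bound a); exact: archi_boundP.
move=> /complex_ge0[-> a0]; exists (Num.bound (complex.Re a)).
by rewrite -[ltRHS](rmorph_nat (real_complex R)) ltcR; exact: archi_boundP.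
Qed.

Lemma real_seq_complete : seq_complete R^o.
Proof. exact: (@completeNormed_seq_complete R R^o). Qed.

Lemma normc_ge_Im (z : R[i]) : `|complex.Im z|%:C <= `|z|.
Proof. by rewrite normc_def lecR -sqrtr_sqr ler_wsqrtr// lerDr sqr_ge0. Qed.

Lemma normc_le_Re_Im (z : R[i]) :
  `|z| <= (`|complex.Re z| + `|complex.Im z|)%:C.
Proof.
case: z => x y.
have -> : x +i* y = x%:C + 'i * y%:C.
  by apply/eqP; rewrite eq_complex /=; apply/andP; split; apply/eqP; ring.
rewrite (le_trans (ler_normD _ _))// normrM.
rewrite !normc_def /= !(expr0n, expr1n, addr0, add0r, mul0r, mul1r, subr0) /=.
by rewrite !sqrtr_sqr sqrtr1 mul1r -rmorphD lecR.
Qed.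

Lemma complex_seq_complete : seq_complete (R[i])^o.
Proof.
move=> u cu.
have [|x ux] := real_seq_complete (u := fun n => complex.Re (u n)).
  move=> e e0; have [|N hN] := cu e%:C; first by rewrite ltcR.
  exists N => n /hN; rewrite -ltcR; apply: le_lt_trans.
  by apply: le_trans (normc_ge_Re _); rewrite raddfB.
have [|y uy] := real_seq_complete (u := fun n => complex.Im (u n)).
  move=> e e0; have [|N hN] := cu e%:C; first by rewrite ltcR.
  exists N => n /hN; rewrite -ltcR; apply: le_lt_trans.
  by apply: le_trans (normc_ge_Im _); rewrite raddfB.
exists (x +i* y) => e /complex_gt0[-> e0].
have e2 : 0 < complex.Re e / 2 by rewrite divr_gt0.
have [N1 hN1] := ux _ e2; have [N2 hN2] := uy _ e2.
exists (maxn N1 N2) => n; rewrite geq_max => /andP[/hN1 h1 /hN2 h2].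
rewrite (le_lt_trans (normc_le_Re_Im _))// ltcR !raddfB /=.
by rewrite (splitr (complex.Re e)) ltrD.
Qed.

Lemma scalar_seq_complete : seq_complete (scalar_field R k)^o.
Proof. by case: k; [exact: real_seq_complete|exact: complex_seq_complete]. Qed.

End ScalarField.

(** * Riesz projectors on eigenvectors *)

Section CircleMean.
Variable R : realType.
Local Open Scope complex_scope.

Definition cis (t : R) : R[i] := cos t +i* sin t.

Lemma cisD s t : cis (s + t) = cis s * cis t.
Proof.
rewrite /cis cosD sinD; apply/eqP; rewrite eq_complex /= eqxx /=.
by apply/eqP; ring.
Qed.

Lemma cis0 : cis 0 = 1.
Proof. by rewrite /cis cos0 sin0. Qed.

Lemma cisMn t n : cis (t *+ n) = cis t ^+ n.
Proof. by elim: n => [|n IH]; [rewrite cis0|rewrite mulrS cisD IH exprS]. Qed.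

Lemma norm_cis t : `|cis t| = 1.
Proof. by rewrite /cis normc_def /= cos2Dsin2 sqrtr1. Qed.

Lemma cis_2pi : cis (2 * pi) = 1.
Proof. by rewrite /cis mulr_natl cos2pi sin2pi. Qed.

Lemma cis_neq1 t : 0 < t < 2 * pi -> cis t != 1.
Proof.
move=> /andP[t0 t2]; rewrite /cis; apply/negP => /eqP[ct st].
have : 0 < sin (t / 2).
  by apply: sin_gt0_pi; rewrite ?divr_gt0// ltr_pdivrMr// mulrC.
have t2E : t / 2 *+ 2 = t by rewrite -mulr_natr divfK.
have := cos_mulr2n (t / 2); rewrite t2E ct.
have := cos2Dsin2 (t / 2).
by nra.
Qed.

Lemma cis_root (N : nat) : (0 < N)%N -> cis (2 * pi / N%:R) ^+ N = 1.
Proof.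
move=> N0; rewrite -cisMn -[_ *+ N]mulr_natr divfK ?cis_2pi//.
by rewrite pnatr_eq0 -lt0n.
Qed.

Lemma sum_cis_root (N m : nat) : (0 < m < N)%N ->
  \sum_(i < N) (cis (2 * pi / N%:R) ^+ m) ^+ i = 0.
Proof.
move=> /andP[m0 mN]; have N0 : (0 < N)%N by exact: leq_trans mN.
set z := cis _ ^+ m.
have z1 : z != 1.
  rewrite /z -cisMn; apply: cis_neq1; rewrite -[_ *+ m]mulr_natr.
  have NR : 0 < N%:R :> R by rewrite ltr0n.
  rewrite mulr_gt0 ?divr_gt0 ?mulr_gt0 ?pi_gt0 ?ltr0n//=.
  rewrite mulrAC ltr_pdivrMr// ltr_pM2l ?ltr_nat//.
  by rewrite mulr_gt0// pi_gt0.
have : z ^+ N - 1 = (z - 1) * \sum_(i < N) z ^+ i by exact: subrX1.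
rewrite /z exprAC cis_root// expr1n subrr => /esym/eqP.
by rewrite mulf_eq0 subr_eq0 (negbTE z1) => /eqP.
Qed.

(** The mean of u / (u - a) over the N-th roots u of r^N, by expansion of
    (u^N - a^N) / (u - a). *)
Lemma circle_mean (N : nat) (r : R) (a : R[i]) : (0 < N)%N -> 0 < r ->
  (forall t, r%:C * cis t != a) -> (r%:C) ^+ N != a ^+ N ->
  \sum_(i < N) (r%:C * cis (2 * pi / N%:R *+ i)) /
    (r%:C * cis (2 * pi / N%:R *+ i) - a) =
  N%:R * (r%:C ^+ N / (r%:C ^+ N - a ^+ N)).
Proof.
move=> N0 r0 ua rNa; set z := cis (2 * pi / N%:R).
set D := r%:C ^+ N - a ^+ N; have D0 : D != 0 by rewrite subr_eq0.
have term (i : 'I_N) : (r%:C * cis (2 * pi / N%:R *+ i)) /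
    (r%:C * cis (2 * pi / N%:R *+ i) - a) =
    \sum_(j < N) (r%:C ^+ (N - j) * a ^+ j / D) * (z ^+ (N - j)) ^+ i.
  have ua' := ua (2 * pi / N%:R *+ i).
  rewrite cisMn -/z in ua' *; set u := r%:C * z ^+ i.
  have uN : u ^+ N = r%:C ^+ N by rewrite exprMn exprAC cis_root// expr1n mulr1.
  have ua0 : u - a != 0 by rewrite subr_eq0.
  have DE : D = (u - a) * \sum_(j < N) u ^+ (N.-1 - j) * a ^+ j.
    by rewrite /D -uN subrXX.
  apply: (mulIf D0); rewrite {1}DE [LHS]mulrA divfK// mulr_sumr mulr_suml.
  apply: eq_bigr => j _; rewrite mulrA -exprS.
  have -> : (N.-1 - j).+1 = (N - j)%N by have := ltn_ord j; lia.
  rewrite exprMn exprAC [RHS]mulrAC [_ / D * D]divfK//.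
  by rewrite mulrAC.
rewrite (eq_bigr _ (fun i _ => term i)) exchange_big /=.
have zN : z ^+ N = 1 by exact: cis_root.
have sumz m : (0 < m < N)%N -> \sum_(i < N) (z ^+ m) ^+ i = 0.
  exact: sum_cis_root.
case: N N0 rNa z D D0 term zN sumz => // N _ rNa z D D0 term zN sumz.
rewrite big_ord_recl /= subn0 expr0 mulr1.
rewrite zN; under eq_bigr do rewrite expr1n mulr1.
rewrite sumr_const card_ord -[_ / D *+ _]mulr_natl big1 ?addr0// => j _.
rewrite -mulr_sumr sumz ?mulr0//.
by rewrite /bump /=; have := ltn_ord j; lia.
Qed.

Lemma pow_ratio_small (x y : R[i]) (e : R) : `|x| < `|y| -> 0 < e ->
  exists N0, forall N, (N0 <= N)%N ->
    y ^+ N != x ^+ N /\ `|x ^+ N / (y ^+ N - x ^+ N)| <= e%:C.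
Proof.
move=> xy e0.
have y0 : y != 0 by rewrite -normr_gt0 (le_lt_trans _ xy).
pose s := complex.Re `|x / y|.
have sE : `|x / y| = s%:C by rewrite /s normc_def.
have s0 : 0 <= s by rewrite -lecR -sE; exact: normr_ge0.
have s1 : s < 1.
  by rewrite -ltcR -sE normrM normfV ltr_pdivrMr ?normr_gt0// mul1r.
pose d := Num.min 2^-1 (e / 2).
have d0 : 0 < d by rewrite lt_min invr_gt0 divr_gt0// ltr0n.
have /cvgrPdist_lt/(_ d d0)[N0 _ hN0] : (s ^+ n)%R @[n --> \oo] --> (0 : R).
  by apply: cvg_expr; rewrite ger0_norm.
exists N0 => N /hN0 /=; rewrite sub0r normrN ger0_norm ?exprn_ge0// => sN.
set t := (x / y) ^+ N.
have tE : `|t| = (s ^+ N)%:C by rewrite normrX sE rmorphXn.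
have t2 : `|t| < (2^-1)%:C.
  by rewrite tE ltcR (lt_le_trans sN)// ge_min lexx.
have te : `|t| <= (e / 2)%:C.
  by rewrite tE lecR ltW// (lt_le_trans sN)// ge_min lexx orbT.
have t1 : (2^-1)%:C <= `|1 - t|.
  rewrite (le_trans _ (lerB_dist _ _))// normr1.
  rewrite lerBrDr -lerBrDl (le_trans (ltW t2))//.
  rewrite -[X in _ <= X - _](rmorph1 (real_complex R)) -rmorphB lecR.
  by lra.
have t10 : 1 - t != 0.
  by rewrite -normr_gt0 (lt_le_trans _ t1)// ltcR invr_gt0.
have yN0 : y ^+ N != 0 by rewrite expf_neq0.
have xE : x ^+ N = t * y ^+ N by rewrite /t exprMn exprVn divfK.
split.
  rewrite xE -subr_eq0 -{1}[y ^+ N]mul1r -mulrBl mulf_eq0 negb_or t10.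
  exact: yN0.
have -> : x ^+ N / (y ^+ N - x ^+ N) = t / (1 - t).
  by rewrite xE -{2}[y ^+ N]mul1r -mulrBl invfM mulrACA divff// mulr1.
rewrite normrM normfV ler_pdivrMr ?normr_gt0//.
rewrite (le_trans te)// -[e / 2]/(e * 2^-1) rmorphM.
by rewrite ler_pM2l// ltcR.
Qed.

End CircleMean.

Section RieszEigenvector.
Variables (R : realType) (Y : normedModType R[i]).
Local Open Scope complex_scope.

Lemma resolvent_eigenvector (A B : Y -> Y) (z l : R[i]) (v : Y) :
  A v = l *: v -> resolvent_at A z B -> (z - l) *: B v = v.
Proof.
move=> Av [[linB _] _ hB]; have [L EL] := linear_bundle linB.
have := congr1 (@^~ v) hB; rewrite /= -[(z *: idfun - A) v]/(z *: v - A v).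
by rewrite Av -scalerBl EL linearZ.
Qed.

Lemma eigenvalue_spectrum (A : Y -> Y) (l : R[i]) (v : Y) :
  A v = l *: v -> v <> 0 -> spectrum A l.
Proof.
move=> Av v0 [B /(resolvent_eigenvector Av)].
by rewrite subrr scale0r => /esym.
Qed.

(** On an eigenvector the Cauchy integral is a scalar integral, whose Riemann
    sums over uniform partitions are means over roots of unity; it is 1 or 0
    according to the position of the eigenvalue. *)
Lemma riesz_projector_eigenvector (A : Y -> Y) (S : set R[i]) (P : Y -> Y)
    (l : R[i]) (v : Y) :
  riesz_projector A S P -> A v = l *: v -> v <> 0 ->
  (S l -> P v = v) /\ (~ S l -> P v = 0).
Proof.
move=> [c [r [Res [r0 hRes SE intP]]]] Av v0.
have res_v z B := @resolvent_eigenvector A B z l v Av.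
have res_l z B : resolvent_at A z B -> z - l != 0.
  move=> /res_v h; apply/eqP => zl; apply: v0.
  by rewrite -h zl scale0r.
have lspec : spectrum A l by exact: eigenvalue_spectrum Av v0.
pose u t := r%:C * cis t.
have norm_u t : `|u t| = r%:C.
  rewrite normrM norm_cis mulr1 normc_def /= expr0n addr0 sqrtr_sqr.
  by rewrite gtr0_norm.
have on_circle t : `|c + u t - c| = r%:C by rewrite addrC addKr norm_u.
pose a := l - c.
have ua t : u t != a.
  have := res_l _ _ (hRes _ (on_circle t)).
  by rewrite subr_eq0 addrC eq_sym -subr_eq eq_sym.
have Resv t : Res (c + u t) v = (u t - a)^-1 *: v.
  have h := res_v _ _ (hRes _ (on_circle t)).
  have uE : c + u t - l = u t - a by rewrite /a opprB addrA addrAC addrC addrA.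
  rewrite -{2}h uE scalerA mulVf ?scale1r//.
  by rewrite subr_eq0; exact: ua.
have a_r : `|a| != r%:C.
  apply/eqP => ar; have := res_l l _ (hRes l ar).
  by rewrite subrr eqxx.
have pi0 : 0 < 2 * pi :> R by rewrite mulr_gt0// pi_gt0.
(* the Riemann sum for N equal arcs, tagged at their origins, is a mean over
   the N-th roots of r^N *)
have riemann (e : R) : 0 < e -> exists N0, forall N, (N0 < N)%N ->
    (r%:C ^+ N != a ^+ N) ->
    `|(r%:C ^+ N / (r%:C ^+ N - a ^+ N)) *: v - P v| <= e%:C * `|v|.
  move=> e0; have [d d0 hd] := intP e e0.
  exists (Num.bound (2 * pi / d)) => N hN rNa.
  have N0 : (0 < N)%N by exact: leq_ltn_trans hN.
  have NR : 0 < N%:R :> R by rewrite ltr0n.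
  pose p (i : nat) : R := 2 * pi / N%:R *+ i.
  have := hd N p p; rewrite /p mulr0n => /(_ erefl).
  rewrite -[_ *+ N]mulr_natr divfK ?gt_eqF// => /(_ erefl) h.
  have mesh (i : nat) :
      2 * pi / N%:R *+ i.+1 - 2 * pi / N%:R *+ i = 2 * pi / N%:R.
    by rewrite mulrS addrK.
  have arc0 : 0 < 2 * pi / N%:R :> R by rewrite divr_gt0.
  have arc_d : 2 * pi / N%:R < d.
    rewrite ltr_pdivrMr// [d * _]mulrC -ltr_pdivrMr//.
    have /archi_boundP/lt_trans : 0 <= 2 * pi / d by rewrite ltW// divr_gt0.
    by apply; rewrite ltr_nat.
  have {}h := h _ v.
  have NC : N%:R != 0 :> R[i] by rewrite pnatr_eq0 -lt0n.
  have mean := circle_mean N0 r0 ua rNa.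
  rewrite -/(u _) in mean.
  have <- : (\sum_(i < N) (2 * pi / N%:R *+ i.+1 - 2 * pi / N%:R *+ i)%:C *:
      (((0 +i* (2 * pi))^-1 * ((0 +i* 1) * u (2 * pi / N%:R *+ i))) *:
        Res (c + u (2 * pi / N%:R *+ i)))) v =
      (r%:C ^+ N / (r%:C ^+ N - a ^+ N)) *: v.
    have -> : r%:C ^+ N / (r%:C ^+ N - a ^+ N) = N%:R^-1 *
        \sum_(i < N) u (2 * pi / N%:R *+ i) / (u (2 * pi / N%:R *+ i) - a).
      by rewrite mean mulKf.
    rewrite fct_sumE mulr_sumr scaler_suml; apply: eq_bigr => i _.
    rewrite mesh; set t := 2 * pi / N%:R *+ i.
    rewrite -[LHS]/((2 * pi / N%:R)%:C *:
      (((0 +i* (2 * pi))^-1 * ((0 +i* 1) * u t)) *: Res (c + u t) v)).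
    rewrite Resv !scalerA; congr (_ *: _).
    have iE (x : R) : 0 +i* x = 'i * x%:C.
      by apply/eqP; rewrite eq_complex /=; apply/andP; split; apply/eqP; ring.
    rewrite iE [0 +i* 1]iE rmorphM fmorphV rmorph_nat rmorph1 mulr1.
    have i0 : 'i != 0 :> R[i] by rewrite eq_complex /= oner_eq0 andbF.
    have p0 : (2 * pi)%:C != 0 :> R[i].
      by rewrite -(rmorph0 (real_complex R)) (inj_eq (@complexI _)) gt_eqF.
    have ut : u t - a != 0 by rewrite subr_eq0; exact: ua.
    have arith (q n b w j : R[i]) : q != 0 -> n != 0 -> b != 0 -> j != 0 ->
        q / n * ((j * q)^-1 * (j * w) / b) = n^-1 * (w / b).
      by move=> q0 n0 b0 j0; field; rewrite q0 n0 b0 j0.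
    exact: arith.
  apply: h => i iN; rewrite lexx -subr_ge0 mesh (ltW arc0); split=> //.
have vgt0 : 0 < `|v| by rewrite normr_gt0; exact/eqP.
have limit (q : R[i]) :
    (forall e : R, 0 < e -> exists N0, forall N, (N0 <= N)%N ->
    r%:C ^+ N != a ^+ N /\
    `|r%:C ^+ N / (r%:C ^+ N - a ^+ N) - q| <= e%:C) -> P v = q *: v.
  move=> hq; apply/eqP; rewrite -subr_eq0; apply/eqP.
  apply: (@norm_small_eq0 _ _ _ (2 * `|v|)); first by rewrite mulr_gt0.
  move=> _e /complex_gt0[-> e0]; set e := complex.Re _e in e0 *.
  have [N1 h1] := riemann e e0; have [N2 h2] := hq e e0.
  pose N := maxn N1.+1 N2.
  have [rN qN] := h2 N (leq_maxr _ _); have vN := h1 N (leq_maxl _ _) rN.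
  set C := _ / _ in qN vN.
  have -> : P v - q *: v = (C - q) *: v - (C *: v - P v).
    by rewrite scalerBl opprB [RHS]addrC addrA subrK.
  rewrite (le_trans (ler_normB _ _))// normrZ -mulrA mulr_natl mulr2n.
  by rewrite [`|v| * _]mulrC lerD// ler_pM2r.
have rC : `|r%:C| = r%:C :> R[i] by rewrite ger0_norm// lecR ltW.
split=> [Sl|nSl].
  rewrite -[RHS]scale1r; apply: limit => e e0.
  have ar : `|a| < `|r%:C| by rewrite rC; move: Sl; rewrite SE => -[].
  have [N0 hN0] := pow_ratio_small ar e0.
  exists N0 => N /hN0[rN hN]; split=> //.
  suff -> : r%:C ^+ N / (r%:C ^+ N - a ^+ N) - 1 =
      a ^+ N / (r%:C ^+ N - a ^+ N).
    by [].
  by field; rewrite subr_eq0.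
rewrite -[RHS](scale0r v); apply: limit => e e0.
have ra : `|r%:C| < `|a|.
  rewrite rC; have : (`|a| < r%:C) || (r%:C < `|a|).
    rewrite -real_neqr_lt// ?normr_real//.
    by rewrite ger0_real// lecR ltW.
  by case/orP => // ar; exfalso; apply: nSl; rewrite SE.
have [N0 hN0] := pow_ratio_small ra e0; exists N0 => N /hN0[rN hN].
rewrite eq_sym rN; split=> //; rewrite subr0.
by move: hN; rewrite !normrM !normfV distrC.
Qed.

End RieszEigenvector.

Lemma positive_riesz_projector_eigenvector (R : realType)
    (Y : normedModType R[i]%C) (A P : Y -> Y) (y : Y) :
  riesz_projector A (spectrum A `&` [set z | 0 < complex.Re z]) P -> y <> 0 ->
  (A y = y -> P y = y) /\ (A y = - y -> P y = 0).
Proof.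
move=> hP y0; split=> Ay.
  have Ay1 : A y = 1 *: y by rewrite scale1r.
  have [+ _] := riesz_projector_eigenvector hP Ay1 y0; apply.
  by split; [exact: eigenvalue_spectrum Ay1 y0|rewrite /= ltr01].
have AyN1 : A y = -1 *: y by rewrite scaleN1r.
have [_ +] := riesz_projector_eigenvector hP AyN1 y0; apply.
by move=> [_] /=; rewrite oppr_gt0 ltr10.
Qed.

Lemma positive_projector_eigenvector (R : realType) (k : scalar_kind)
    (Y : normedModType (scalar_field R k)) (T P : Y -> Y) (y : Y) :
  linear T -> is_positive_projector T P -> y <> 0 ->
  (T y = y -> P y = y) /\ (T y = - y -> P y = 0).
Proof.
case: k Y T P y => Y T P y linT [[linP _] hP] y0; last first.
  exact: positive_riesz_projector_eigenvector.
have [LT ET] := linear_bundle linT.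
have y0' : ((y, 0) : complexification Y) <> 0 by case.
have [h1 h2] := positive_riesz_projector_eigenvector hP y0'.
have T0 : T 0 = 0 by rewrite ET linear0.
split=> Ty.
  suff : (P y, P 0) = ((y, 0) : complexification Y) by case.
  by apply: h1; rewrite /= Ty T0.
suff : (P y, P 0) = (0 : complexification Y) by case.
by apply: h2; rewrite /= Ty T0 -[RHS]/(- y, - 0) oppr0.
Qed.

(** The space being the sum of the eigenspaces of [2 P_F - 1] for 1 and -1,
    its positive spectral projector is [P_F]. *)
Lemma positive_projector_reflection (R : realType) (k : scalar_kind)
    (F G : normedModType (scalar_field R k))
    (P : (F * G)%type -> (F * G)%type) :
  is_positive_projector
    (2%:R *: @left_projector _ F G - idfun : (F * G)%type -> (F * G)%type) P ->
  P = @left_projector _ F G.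
Proof.
move=> hP; have [LP EP] := linear_bundle hP.1.1.
pose T : (F * G)%type -> (F * G)%type := 2%:R *: @left_projector _ F G - idfun.
have linT : linear T.
  move=> a u v; rewrite -![T _]/(2%:R *: left_projector _ - _).
  rewrite left_projector_linear scalerDr opprD addrACA scalerBr !scalerA.
  by rewrite mulrC.
apply/funext => -[x y].
have xyE : (x, y) = (x, 0) + (0, y) :> (F * G)%type.
  by rewrite -[RHS]/(x + 0, 0 + y) addr0 add0r.
have Px : P (x, 0) = (x, 0).
  have [->|/eqP x0] := eqVneq x 0; first by rewrite EP linear0.
  have [|h _] := positive_projector_eigenvector linT hP (y := (x, 0)).
    by case.
  apply: h; rewrite -[T _]/(2%:R *: x - x, 2%:R *: 0 - 0).
  by rewrite scaler0 subrr scaler_nat mulr2n addrK.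
have Py : P (0, y) = 0.
  have [->|/eqP y0] := eqVneq y 0; first by rewrite EP linear0.
  have [|_ h] := positive_projector_eigenvector linT hP (y := (0, y)).
    by case.
  apply: h; rewrite -[T _]/(2%:R *: 0 - 0, 2%:R *: 0 - y).
  by rewrite !scaler0 subrr sub0r -[RHS]/(- 0, - y) oppr0.
by rewrite xyE EP linearD -EP Px Py addr0 /left_projector /= addr0.
Qed.

(** * Vanishing of the spectral flow *)

Theorem proposition4p13 (R : realType) (k : scalar_kind)
    (F G : completeNormedModType (scalar_field R k))
    (hGF : forall T : G -> F, bounded_op T -> compact_op T)
    (hF : isomorphic_to_hyperplanes F)
    (hG : isomorphic_to_hyperplanes G) :
  let X : normedModType (scalar_field R k) := (F * G)%type in
  let P_F : X -> X := @left_projector _ F G in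
  forall C : set (R -> X -> X),
    fundamental_group (@ess_hyperbolic R k X) (2%:R *: P_F - idfun) C ->
    forall n : int, spectral_flow_hom C n -> n = 0.
Proof.
move=> X P_F C [A0 _ ->] n [A [[_ _ A_0 A_1] _]].
move=> [Q [Pp [cQ hQ [k0 [k1 [h0 h1 ->]]]]]].
have in0 : 0 <= (0 : R) <= 1 by rewrite lexx ler01.
have in1 : 0 <= (1 : R) <= 1 by rewrite ler01 lexx.
have Pp0 : Pp 0 = P_F.
  by have [_ + _] := hQ _ in0; rewrite A_0; exact: positive_projector_reflection.
have Pp1 : Pp 1 = P_F.
  by have [_ + _] := hQ _ in1; rewrite A_1; exact: positive_projector_reflection.
rewrite Pp0 in h0; rewrite Pp1 in h1.
suff -> : k0 = k1 by rewrite subrr.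
apply: relative_dim_constant cQ _ _ h0 h1 => //.
- exact: scalar_archimedean.
- exact: scalar_seq_complete.
- by move=> t /hQ[].
have [_ _] := hQ _ in0; rewrite Pp0 => /compact_totally_bounded tb.
rewrite (_ : corner (Q 0) - id =
  (fst : X -> F) \o ((Q 0 - P_F) \o (fun x => (x, 0)))).
  have lin0 : linear (Q 0 - P_F).
    have [[[lQ _] _] _ _] := hQ _ in0.
    move=> a u v; rewrite -![(Q 0 - P_F) _]/(Q 0 _ - P_F _).
    by rewrite lQ /P_F left_projector_linear opprD addrACA scalerBr.
  apply: totally_bounded_compl.
  - exact: (bounded_fst F G).1.
  - exact: bounded_op_opnorm (bounded_fst F G).
  - by apply: totally_bounded_compr => //; exact: opnorm_inl.
by apply/funext => x.
Qed.
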